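(* Let $X$ and $Y$ be perfectly normal Hausdorff spaces and $\mu\in\mathcal{P}_r(X)$, $\nu\in\mathcal{P}_r(Y)$ Radon probability measures. Then $\Gamma(\mu,\nu)=\Pi(\mu,\nu)$, in the sense that for every $\gamma\in\Gamma(\mu,\nu)$ the functional $f\mapsto\int_{X\times Y}f\,d\gamma$ on $C_b(X\times Y)$ is given by integration against a Radon probability measure on $X\times Y$ belonging to $\Pi(\mu,\nu)$, and conversely every element of $\Pi(\mu,\nu)$ (restricted to $\mathcal{U}(X\times Y)$) belongs to $\Gamma(\mu,\nu)$. Consequently the problems $(\mathbf{OP})$ and $(\mathbf{KP})$ coincide, and if $c\in lsc_{bi}(X\times Y)$ satisfies $v_{\min}(\mathbf{KP})<+\infty$, then $(\mathbf{KP})$ has a solution.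
   Context: $C_b(Z)$: real-valued bounded continuous functions on $Z$. $\mathcal{U}(Z)$: algebra generated by zero-sets. $\mathcal{M}^1(Z)$: finitely additive $\gamma:\mathcal{U}(Z)\to[0,\infty)$, $\gamma(Z)=1$, regular (for every $A\in\mathcal{U}(Z)$, $\varepsilon>0$ there is a zero-set $F\subseteq A$ with $\gamma(A\setminus F)<\varepsilon$). $lsc_{bi}(Z)$: proper bounded-below lower semicontinuous $g:Z\to\mathbb{R}\cup\{+\infty\}$, with $\int g\,d\gamma:=\sup\{\int fd\gamma: f\in C_b(Z),f\le g\}$. A Radon measure is a Borel measure $\mu$ such that for every Borel $B$ and $\varepsilon>0$ there is a compact $K\subseteq B$ with $|\mu|(B\setminus K)<\varepsilon$; $\mathcal{P}_r$ denotes Radon probability measures. $(\phi\oplus\psi)(x,y):=\phi(x)+\psi(y)$. $\Gamma(\mu,\nu):=\{\gamma\in\mathcal{M}^1(X\times Y):\int\phi\oplus\psi\,d\gamma=\int\phi\,d\mu+\int\psi\,d\nu\ \forall\phi\in C_b(X),\psi\in C_b(Y)\}$, $v_{\min}(\mathbf{OP}):=\inf\{\int c\,d\gamma:\gamma\in\Gamma(\mu,\nu)\}$. $\Pi(\mu,\nu):=\{\gamma\in\mathcal{P}_r(X\times Y):(\pi_X)_\#\gamma=\mu,(\pi_Y)_\#\gamma=\nu\}$ (Radon probability measures on $X\times Y$ with marginals $\mu,\nu$), and $v_{\min}(\mathbf{KP}):=\inf\{\int c\,d\gamma:\gamma\in\Pi(\mu,\nu)\}$. *)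

(* Defs.v *)
From HB Require Import structures.
From mathcomp Require Import all_boot all_order all_algebra.
From mathcomp Require Import all_classical all_reals all_analysis.
From mathcomp Require Import borel_hierarchy.

Set Implicit Arguments.
Unset Strict Implicit.
Unset Printing Implicit Defensive.

Import Order.TTheory GRing.Theory Num.Theory.
Import numFieldNormedType.Exports.

Local Open Scope classical_set_scope.
Local Open Scope ring_scope.

Definition perfectly_normal (T : topologicalType) : Prop :=
  normal_space T /\ (forall C : set T, closed C -> Gdelta C).

Definition Borel (T : ptopologicalType) := g_sigma_algebraType (@open T).

Section prod_ptopological.
Variables X Y : ptopologicalType.
HB.instance Definition _ := Pointed.on (X * Y)%type.
End prod_ptopological.

Section Defs.
Context {R : realType}.

Definition Cb (Z : topologicalType) (f : Z -> R) : Prop :=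
  continuous f /\ exists M : R, forall z, `|f z| <= M.

Definition zero_set (Z : topologicalType) (A : set Z) : Prop :=
  exists f : Z -> R, continuous f /\ A = f @^-1` [set 0].

Definition set_algebra (Z : Type) (M : set (set Z)) : Prop :=
  [/\ M set0, (forall A, M A -> M (~` A)) &
      (forall A B, M A -> M B -> M (A `|` B))].

Definition Ualg (Z : topologicalType) : set (set Z) :=
  smallest (@set_algebra Z) (@zero_set Z).

(** M^1(Z): regular finitely additive probabilities on U(Z)
   (only the values on U(Z) matter). *)
Definition fa_prob (Z : topologicalType) (g : set Z -> R) : Prop :=
  [/\ (forall A, Ualg A -> 0 <= g A),
      g setT = 1,
      (forall A B, Ualg A -> Ualg B -> A `&` B = set0 ->
          g (A `|` B) = g A + g B) &
      (forall A, Ualg A -> forall eps : R, 0 < eps ->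
          exists F, [/\ zero_set F, F `<=` A & g (A `\` F) < eps])].

Definition fa_int (Z : topologicalType) (g : set Z -> R) (f : Z -> R)
  : \bar R :=
  ereal_sup [set x : \bar R | exists n (a : 'I_n -> R) (A : 'I_n -> set Z),
    [/\ (forall i, Ualg (A i)),
        (forall z, \sum_(i < n) a i * \1_(A i) z <= f z) &
        x = (\sum_(i < n) a i * g (A i))%:E]].

Definition lsc_int (Z : topologicalType) (g : set Z -> R) (c : Z -> \bar R)
  : \bar R :=
  ereal_sup [set fa_int g f | f in [set f : Z -> R |
                                     Cb f /\ forall z, ((f z)%:E <= c z)%E]].

Definition lsc_bi (Z : topologicalType) (c : Z -> \bar R) : Prop :=
  [/\ lower_semicontinuous c,
      (exists z, (c z < +oo)%E) &
      (exists M : R, forall z, (M%:E <= c z)%E)].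

Definition radon_prob (Z : ptopologicalType)
  (mu : {measure set (Borel Z) -> \bar R}) : Prop :=
  mu setT = 1%E /\
  forall B : set (Borel Z), measurable B -> forall eps : R, 0 < eps ->
    exists K : set Z, [/\ compact K, K `<=` B & (mu (B `\` K) < eps%:E)%E].

Section Plans.
Context {X Y : ptopologicalType}.
Variables (mu : {measure set (Borel X) -> \bar R})
          (nu : {measure set (Borel Y) -> \bar R}).

Definition Gamma (g : set (X * Y) -> R) : Prop :=
  fa_prob g /\
  forall (phi : X -> R) (psi : Y -> R), Cb phi -> Cb psi ->
    fa_int g (fun z => phi z.1 + psi z.2) =
    (\int[mu]_x (phi x)%:E + \int[nu]_y (psi y)%:E)%E.

Definition Pi (p : {measure set (Borel (X * Y)%type) -> \bar R}) : Prop :=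
  [/\ radon_prob p,
      (forall A : set (Borel X), measurable A -> p (A `*` setT) = mu A) &
      (forall B : set (Borel Y), measurable B -> p (setT `*` B) = nu B)].

Definition vmin_OP (c : X * Y -> \bar R) : \bar R :=
  ereal_inf [set lsc_int g c | g in Gamma].

Definition vmin_KP (c : X * Y -> \bar R) : \bar R :=
  ereal_inf [set (\int[p]_z c z)%E | p in Pi].

End Plans.
End Defs.

(* Main.v *)
Require Import Defs.
From HB Require Import structures.
From mathcomp Require Import all_boot all_order all_algebra.
From mathcomp Require Import all_classical all_reals all_analysis.
From mathcomp Require Import measurable_realfun finmap.
From mathcomp Require Import ring lra.

Set Implicit Arguments.
Unset Strict Implicit.
Unset Printing Implicit Defensive.

Import Order.TTheory GRing.Theory Num.Theory.
Import numFieldNormedType.Exports.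
Import HBNNSimple.
Local Open Scope classical_set_scope.
Local Open Scope ring_scope.

(** Everything on [X * Y] reduces to a content [g] (finitely additive, not
    necessarily regular) on the algebra of zero-sets.  Because the marginals
    are Radon, [g] is tight: zero-sets missing a suitable compact rectangle have
    small content.  Tightness makes [U |-> sup {g F | F zero-set in U}] countably
    subadditive on open sets, and the outer measure it generates restricts to a
    Radon probability [p] with [p <= g] on cozero sets.  Approximating bounded
    functions by staircases of superlevel sets gives
    [\int f dp <= \int f dg], and applying this to [- f] gives equality on C_b.
    Since Radon probabilities are determined by C_b, [p] has the right marginals.
    An optimal plan arises from the content obtained as the limit, along an
    ultrafilter, of a minimizing sequence: that content need not be regular, but
    the construction above does not need regularity. *)

(** * Zero-sets and the algebra they generate *)

(** What does pass to products is the separation of a compact set from a disjoint closed set,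
    [compact_open_separated], and the bump functions used below have this form. The marginal
    conditions see only functions of one coordinate, so a zero-set missing a compact rectangle is
    first covered by two zero-sets, each depending on one coordinate; this is where the tube lemma
    enters. [fa_int] is a supremum of lower sums, so a limit of contents naturally yields upper
    bounds for it, which explains the many one-sided hypotheses. The cost fits the same scheme:
    against a Radon probability its integral is the supremum over the continuous bounded minorants,
    hence depends only on the functional on C_b. *)

Section zero_sets.
Context {R : realType} {Z : topologicalType}.
Implicit Types (f : Z -> R) (A B : set Z).

Local Notation zero_set := (@zero_set R Z).
Local Notation Ualg := (@Ualg R Z).

Lemma zero_set_ge f (t : R) : continuous f -> zero_set [set z | t <= f z].
Proof.
move=> cf; exists (fun z => Num.min (f z - t) 0); split.
  move=> z; apply: (@continuous_min _ _ (fun z => f z - t) (cst 0)); last exact: cst_continuous.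
  by apply: cvgB; [exact: cf|exact: cvg_cst].
apply/seteqP; split=> z /=.
  by move=> tf; apply/min_idPr; rewrite subr_ge0.
by move/min_idPr; rewrite subr_ge0.
Qed.

Lemma zero_set_le f (t : R) : continuous f -> zero_set [set z | f z <= t].
Proof.
move=> cf; have := @zero_set_ge (fun z => - f z) (- t).
under eq_set do rewrite lerN2.
by apply=> z; apply: cvgN; exact: cf.
Qed.

Lemma zero_setI A B : zero_set A -> zero_set B -> zero_set (A `&` B).
Proof.
move=> [f [cf ->]] [g [cg ->]]; exists (fun z => `|f z| + `|g z|); split.
  by move=> z; apply: cvgD; apply: cvg_norm; [exact: cf|exact: cg].
apply/seteqP; split=> z /=; first by move=> [-> ->]; rewrite normr0 addr0.
move/eqP; rewrite paddr_eq0 ?normr_ge0// !normr_eq0 => /andP[/eqP ? /eqP ?].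
by split.
Qed.

Lemma zero_setU A B : zero_set A -> zero_set B -> zero_set (A `|` B).
Proof.
move=> [f [cf ->]] [g [cg ->]]; exists (fun z => f z * g z); split.
  by move=> z; apply: cvgM; [exact: cf|exact: cg].
apply/seteqP; split=> z /=; first by move=> [] ->; rewrite (mul0r, mulr0).
by move/eqP; rewrite mulf_eq0 => /orP[]/eqP ?; [left|right].
Qed.

Lemma zero_set_closed A : zero_set A -> closed A.
Proof.
move=> [f [cf ->]]; exact: preimage_closed.
Qed.

Lemma zero_set0 : zero_set set0.
Proof.
exists (cst 1); split; first exact: cst_continuous.
by apply/seteqP; split=> z //= /eqP; rewrite oner_eq0.
Qed.

Lemma zero_setT : zero_set setT.
Proof.
exists (cst 0); split; first exact: cst_continuous.
by apply/seteqP; split.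
Qed.

Lemma Ualg_zero A : zero_set A -> Ualg A.
Proof. exact: sub_smallest. Qed.

Lemma Ualg0 : Ualg set0. Proof. exact: Ualg_zero zero_set0. Qed.

Lemma UalgC A : Ualg A -> Ualg (~` A).
Proof. by move=> UA M [[M0 MC MU] zM]; exact/MC/(UA _ (conj (And3 M0 MC MU) zM)). Qed.

Lemma UalgU A B : Ualg A -> Ualg B -> Ualg (A `|` B).
Proof.
move=> UA UB M [[M0 MC MU] zM]; have hM := conj (And3 M0 MC MU) zM.
exact: MU (UA _ hM) (UB _ hM).
Qed.

Lemma UalgT : Ualg setT. Proof. by rewrite -setC0; exact: UalgC Ualg0. Qed.

Lemma UalgI A B : Ualg A -> Ualg B -> Ualg (A `&` B).
Proof. by move=> UA UB; rewrite -[A `&` B]setCK setCI; exact: UalgC (UalgU (UalgC UA) (UalgC UB)). Qed.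

Lemma UalgD A B : Ualg A -> Ualg B -> Ualg (A `\` B).
Proof. by move=> UA UB; rewrite setDE; apply: UalgI => //; exact: UalgC. Qed.

Lemma Ualg_gt f (t : R) : continuous f -> Ualg [set z | t < f z].
Proof.
move=> cf; rewrite [X in Ualg X](_ : _ = ~` [set z | f z <= t]).
  exact: UalgC (Ualg_zero (zero_set_le _ cf)).
by apply/seteqP; split=> z /=; rewrite ltNge => /negP.
Qed.

End zero_sets.

(** * Borel measurability of the zero-set algebra and of continuous functions *)

Section borel.
Context {R : realType} {Z : ptopologicalType}.

Lemma Borel_open (U : set Z) : open U -> measurable (U : set (Borel Z)).
Proof. exact: sub_sigma_algebra. Qed.

Lemma Borel_closed (F : set Z) : closed F -> measurable (F : set (Borel Z)).
Proof.
by move=> cF; rewrite -[F]setCK; apply: measurableC; apply: Borel_open; rewrite openC.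
Qed.

Lemma Ualg_Borel (A : set Z) : @Ualg R Z A -> measurable (A : set (Borel Z)).
Proof.
move=> /(_ (measurable : set (set (Borel Z)))); apply; split.
  split; first exact: (@measurable0 _ (Borel Z)).
    exact: (@measurableC _ (Borel Z)).
  exact: (@measurableU _ (Borel Z)).
by move=> B /zero_set_closed; exact: Borel_closed.
Qed.

Lemma continuous_Borel (f : Z -> R) :
  continuous f -> measurable_fun setT (f : Borel Z -> R).
Proof.
move=> cf; apply: (measurability _ (RGenOInfty.measurableE R)) => //.
move=> _ [_ [a ->] <-]; rewrite setTI; apply: Borel_open.
by apply: open_comp; [move=> x _; exact: cf|exact: interval_open].
Qed.

End borel.

(** * Contents and their integral *)

Definition fa_content {R : realType} {Z : topologicalType} (g : set Z -> R) :=
  [/\ (forall A, @Ualg R Z A -> 0 <= g A), g setT = 1 &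
      (forall A B, @Ualg R Z A -> @Ualg R Z B -> A `&` B = set0 ->
        g (A `|` B) = g A + g B)].

Section fa_content.
Context {R : realType} {Z : topologicalType}.
Variable g : set Z -> R.
Hypothesis cg : fa_content g.
Implicit Types (f : Z -> R) (A B : set Z).

Local Notation zero_set := (@zero_set R Z).
Local Notation Ualg := (@Ualg R Z).

Lemma content_ge0 A : Ualg A -> 0 <= g A. Proof. by case: cg => + _ _; apply. Qed.

Lemma contentT : g setT = 1. Proof. by case: cg. Qed.

Lemma contentU A B : Ualg A -> Ualg B -> A `&` B = set0 -> g (A `|` B) = g A + g B.
Proof. by case: cg => _ _; apply. Qed.

Lemma content0 : g set0 = 0.
Proof.
have := contentU Ualg0 Ualg0 (set0I _); rewrite set0U => /eqP.
by rewrite -subr_eq subrr eq_sym => /eqP.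
Qed.

Lemma content_split A B : Ualg A -> Ualg B -> g A = g (A `&` B) + g (A `\` B).
Proof.
move=> UA UB; rewrite -contentU ?setUIDK//.
- exact: UalgI.
- exact: UalgD.
- by rewrite setDE setIACA setICr setI0.
Qed.

Lemma content_le A B : Ualg A -> Ualg B -> A `<=` B -> g A <= g B.
Proof.
move=> UA UB AB; rewrite (content_split UB UA) (setIidr AB) lerDl.
exact: content_ge0 (UalgD UB UA).
Qed.

Lemma content_leU A B : Ualg A -> Ualg B -> g (A `|` B) <= g A + g B.
Proof.
move=> UA UB; rewrite (content_split (UalgU UA UB) UA).
rewrite lerD// content_le//.
- by apply: UalgI => //; exact: UalgU.
- by apply: UalgD => //; exact: UalgU.
- by move=> z [[]].
Qed.

(** The localization to [E] and the constant [c] make the induction work without a common refinement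
    of the [A i]: splitting [E] along the first set changes the constant to [c + a ord0] inside it
    and leaves [c] outside. *)
Lemma content_simple_ge0 n (a : 'I_n -> R) (A : 'I_n -> set Z) (E : set Z) (c : R) :
  Ualg E -> (forall i, Ualg (A i)) ->
  (forall z, E z -> 0 <= c + \sum_(i < n) a i * \1_(A i) z) ->
  0 <= c * g E + \sum_(i < n) a i * g (E `&` A i).
Proof.
elim: n a A E c => [|n IH] a A E c UE UA h.
  rewrite big_ord0 addr0.
  have [->|/set0P[z Ez]] := eqVneq E set0; first by rewrite content0 mulr0.
  by have := h _ Ez; rewrite big_ord0 addr0 => c0; rewrite mulr_ge0// content_ge0.
pose A' i := A (lift ord0 i); pose a' i := a (lift ord0 i); pose B := A ord0.
have UB : Ualg B by exact: UA.
have h1 : 0 <= (c + a ord0) * g (E `&` B) + \sum_(i < n) a' i * g (E `&` B `&` A' i).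
  apply: IH => [||z [Ez Bz]]; [exact: UalgI|by move=> i; exact: UA|].
  by have := h _ Ez; rewrite big_ord_recl addrA indicE mem_set// mulr1.
have h2 : 0 <= c * g (E `\` B) + \sum_(i < n) a' i * g ((E `\` B) `&` A' i).
  apply: IH => [||z [Ez Bz]]; [exact: UalgD|by move=> i; exact: UA|].
  by have := h _ Ez; rewrite big_ord_recl indicE memNset// mulr0 add0r.
have gE i : a i * g (E `&` A i) = a i * g (E `&` B `&` A i) + a i * g ((E `\` B) `&` A i).
  rewrite (content_split (UalgI UE (UA i)) UB).
  by rewrite mulrDr (setIAC E (A i) B) !setDE (setIAC E (A i)).
have := addr_ge0 h1 h2; rewrite big_ord_recl (@content_split E B)//.
under [X in _ -> _ <= _ + (_ + X)]eq_bigr do rewrite gE.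
rewrite big_split/= => /le_trans; apply; rewrite le_eqVlt; apply/orP; left.
by apply/eqP; rewrite /A' /a'; ring.
Qed.

Lemma content_simple_le n (a : 'I_n -> R) (A : 'I_n -> set Z) m (b : 'I_m -> R)
    (B : 'I_m -> set Z) (c d : R) :
  (forall i, Ualg (A i)) -> (forall i, Ualg (B i)) ->
  (forall z, c + \sum_(i < n) a i * \1_(A i) z <= d + \sum_(i < m) b i * \1_(B i) z) ->
  c + \sum_(i < n) a i * g (A i) <= d + \sum_(i < m) b i * g (B i).
Proof.
move=> UA UB h.
(* Both families are merged into one, with coefficients [- a] and [b]. [sumE] holds for any set
   function, so it serves both for [g] and for the indicators at a point. *)
pose C (i : 'I_(n + m)) := match fintype.split i with inl j => A j | inr j => B j end.
pose e (i : 'I_(n + m)) := match fintype.split i with inl j => - a j | inr j => b j end.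
have sumE (F : set Z -> R) : \sum_(i < n + m) e i * F (C i) =
    - \sum_(i < n) a i * F (A i) + \sum_(i < m) b i * F (B i).
  rewrite big_split_ord /= -sumrN; congr (_ + _); apply: eq_bigr => i _.
    rewrite /e /C; case: split_ordP => j; last by move/eqP; rewrite eq_lrshift.
    by move/lshift_inj => ->; rewrite mulNr.
  rewrite /e /C; case: split_ordP => j; first by move/eqP; rewrite eq_rlshift.
  by move/rshift_inj => ->.
have UC i : Ualg (C i) by rewrite /C; case: splitP.
have := @content_simple_ge0 _ e C setT (d - c) UalgT UC.
under eq_bigr do rewrite setTI.
rewrite sumE contentT mulr1 => H; rewrite -subr_ge0.
have {}H : 0 <= d - c + (- \sum_(i < n) a i * g (A i) + \sum_(i < m) b i * g (B i)).
  apply: H => z _; rewrite (sumE (fun D => \1_D z)).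
  have := h z; rewrite -subr_ge0 => /le_trans; apply.
  by rewrite le_eqVlt; apply/orP; left; apply/eqP; ring.
by apply: (le_trans H); rewrite le_eqVlt; apply/orP; left; apply/eqP; ring.
Qed.

Lemma fa_int_ge n (a : 'I_n -> R) (A : 'I_n -> set Z) (c : R) f :
  (forall i, Ualg (A i)) -> (forall z, c + \sum_(i < n) a i * \1_(A i) z <= f z) ->
  ((c + \sum_(i < n) a i * g (A i))%:E <= fa_int g f)%E.
Proof.
move=> UA h; apply: ereal_sup_ubound.
(* The constant becomes one more term, with coefficient [c] on the whole space, where [g] is 1. *)
exists n.+1, (oapp a c \o unlift ord0), (oapp A setT \o unlift ord0).
split.
- move=> i /=; case: unliftP => [j _|_] //=; exact: UalgT.
- move=> z; rewrite big_ord_recl /= unlift_none /= indicT mulr1.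
  by under eq_bigr do rewrite liftK /=.
- rewrite big_ord_recl /= unlift_none /= contentT mulr1.
  by under [in RHS]eq_bigr do rewrite liftK /=.
Qed.

Lemma fa_int_le n (a : 'I_n -> R) (A : 'I_n -> set Z) (c : R) f :
  (forall i, Ualg (A i)) -> (forall z, f z <= c + \sum_(i < n) a i * \1_(A i) z) ->
  (fa_int g f <= (c + \sum_(i < n) a i * g (A i))%:E)%E.
Proof.
move=> UA h; apply: ge_ereal_sup => _ [m [b [B [UB hb ->]]]].
rewrite lee_fin -[leLHS]add0r; apply: content_simple_le => // z.
by rewrite add0r; exact: le_trans (hb z) (h z).
Qed.

End fa_content.

(** * Uniform approximation of bounded functions by staircases *)

Section staircase.
Context {R : realType}.

(** The sum is [d] times the number of thresholds [d, ..., N * d] strictly below [y]. If the last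
    threshold is below [y], all are, and the sum has a closed form; otherwise the last term vanishes
    and the induction hypothesis applies. *)
Lemma staircase_sum (d y : R) N : 0 <= d -> 0 <= y ->
  [/\ \sum_(i < N) d * (i.+1%:R * d < y)%R%:R <= N%:R * d,
      \sum_(i < N) d * (i.+1%:R * d < y)%R%:R <= y &
      y <= N.+1%:R * d -> y <= d + \sum_(i < N) d * (i.+1%:R * d < y)%R%:R].
Proof.
move=> d0 y0; elim: N => [|N [h1 h2 h3]].
  by rewrite big_ord0 mul0r mul1r addr0; split.
rewrite big_ord_recr /=.
have [ltN|leN] := ltP (N.+1%:R * d) y; last first.
  rewrite mulr0 addr0; split => //.
    by apply: le_trans h1 _; rewrite ler_wpM2r// ler_nat.
  by move=> _; exact: h3.
have -> : \sum_(i < N) d * (i.+1%:R * d < y)%R%:R = N%:R * d.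
  under eq_bigr => i _.
    rewrite (_ : (_ < y) = true) ?mulr1; last first.
      by apply: le_lt_trans ltN; rewrite ler_wpM2r// ler_nat ltnW// ltnS.
    over.
  by rewrite sumr_const card_ord mulr_natl.
rewrite mulr1; split.
- by rewrite -natr1 mulrDl mul1r.
- by apply: ltW; rewrite -natr1 mulrDl mul1r in ltN.
- by move/le_trans; apply; rewrite -!natr1 !mulrDl mul1r; lra.
Qed.

Lemma indic_bool (T : Type) (b : T -> bool) z : \1_[set x | b x] z = (b z)%:R :> R.
Proof.
rewrite indicE; have [bz|bz] := boolP (b z).
  by rewrite mem_set.
by rewrite memNset//; exact/negP. Qed.

(** Strict superlevel sets are used because they lie in the zero-set algebra when [f] is continuous
    and are open when [f] is lower semicontinuous, so one staircase serves contents and costs. *)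
Lemma staircase (T : Type) (f : T -> R) (M eps : R) : (forall z, `|f z| <= M) -> 0 < eps ->
  exists n (d : R) (t : 'I_n -> R) , [/\ 0 <= d,
    (forall z, - M + \sum_(i < n) d * \1_[set z | t i < f z] z <= f z) &
    (forall z, f z <= eps - M + \sum_(i < n) d * \1_[set z | t i < f z] z)].
Proof.
move=> fM e0.
(* [f + M] takes values in the interval from 0 to [2 * M], which [N.+1] steps of height [eps] must
   cover. *)
have [N hN] : exists N, 2 * M <= N.+1%:R * eps.
  exists (Num.truncn (2 * M / eps)).
  rewrite -ler_pdivrMr//; apply: ltW; exact: truncnS_gt.
exists N, eps, (fun i => i.+1%:R * eps - M); split=> [|z|z]; first exact: ltW.
  have fM0 : 0 <= f z + M by have := fM z; rewrite ler_norml => /andP[]; lra.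
  have [_ + _] := staircase_sum N (ltW e0) fM0.
  under eq_bigr do rewrite -ltrBlDr.
  by under [in X in _ -> X]eq_bigr do rewrite indic_bool; lra.
have fM0 : 0 <= f z + M by have := fM z; rewrite ler_norml => /andP[]; lra.
have [_ _] := staircase_sum N (ltW e0) fM0.
under eq_bigr do rewrite -ltrBlDr.
under [in X in _ -> X]eq_bigr do rewrite indic_bool.
have : f z + M <= N.+1%:R * eps by have := fM z; rewrite ler_norml => /andP[]; lra.
by move=> /[swap] /[apply]; lra.
Qed.

End staircase.

(** * Comparison of integrals against contents and against probabilities *)

Section integral_content.
Context {R : realType} {Z : ptopologicalType}.
Implicit Types (q : {measure set (Borel Z) -> \bar R}) (f : Z -> R).

Lemma prob_le1 q (A : set (Borel Z)) : q setT = 1%E -> measurable A -> (q A <= 1)%E.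
Proof. by move=> q1 mA; rewrite -q1; apply: le_measure => //; exact/mem_set. Qed.

Lemma prob_fin q (A : set (Borel Z)) : q setT = 1%E -> measurable A -> q A \is a fin_num.
Proof.
move=> q1 mA; rewrite ge0_fin_numE//; apply: le_lt_trans (prob_le1 q1 mA) _.
exact: ltry.
Qed.

Lemma prob_content q : q setT = 1%E -> fa_content (fun A : set Z => fine (q A)).
Proof.
move=> q1; split=> [A _||A B UA UB AB0]; first exact: fine_ge0.
  by rewrite q1.
have mA := Ualg_Borel UA; have mB := Ualg_Borel UB.
by rewrite (@measureU _ _ _ q) // fineD// prob_fin.
Qed.

Lemma Cb_integrable q f : q setT = 1%E -> Cb f -> q.-integrable setT (EFin \o f).
Proof.
move=> q1 [cf [M fM]]; apply: (@measurable_bounded_integrable _ (Borel Z)) => //.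
- by rewrite q1 ltry.
- exact: continuous_Borel.
- exists M; split; first exact: num_real.
  by move=> x Mx z _ /=; apply: (le_trans (fM z)); exact: ltW.
Qed.

Lemma indic_integrable q (A : set (Borel Z)) : q setT = 1%E -> measurable A ->
  q.-integrable setT (fun z => (\1_A z : R)%:E).
Proof.
move=> q1 mA; apply: (@measurable_bounded_integrable _ _ _ q (\1_A : Borel Z -> R)) => //.
  by rewrite q1 ltry.
exists 1; split; first exact: num_real.
by move=> x x1 z _ /=; rewrite indicE normr_nat ltW// (le_lt_trans _ x1)// lern1 leq_b1.
Qed.

Lemma simple_integrable q n (c : R) (a : 'I_n -> R) (A : 'I_n -> set (Borel Z)) :
  q setT = 1%E -> (forall i, measurable (A i)) ->
  q.-integrable setT (fun z => (c + \sum_(i < n) a i * \1_(A i) z)%:E).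
Proof.
move=> q1 mA; under eq_fun do rewrite EFinD -sumEFin.
have qfin : (q setT < +oo)%E by rewrite q1 ltry.
apply: integrableD => //.
  apply: (@measurable_bounded_integrable _ _ _ q (fun=> c)) => //.
  by exists `|c|; split; [exact: num_real|move=> x cx z _ /=; exact: ltW].
apply: integrable_sum => // i _; under eq_fun do rewrite EFinM.
by apply: integrableZl => //; exact: indic_integrable.
Qed.

Lemma integral_simple q n (c : R) (a : 'I_n -> R) (A : 'I_n -> set (Borel Z)) :
  q setT = 1%E -> (forall i, measurable (A i)) ->
  (\int[q]_z (c + \sum_(i < n) a i * \1_(A i) z)%:E =
   (c + \sum_(i < n) a i * fine (q (A i)))%:E)%E.
Proof.
move=> q1 mA; under eq_integral do rewrite EFinD -sumEFin.
have qfin : (q setT < +oo)%E by rewrite q1 ltry.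
rewrite integralD//; first last.
- apply: integrable_sum => // i _; under eq_fun do rewrite EFinM.
  by apply: integrableZl => //; exact: indic_integrable.
- apply: (@measurable_bounded_integrable _ _ _ q (fun=> c)) => //.
  by exists `|c|; split; [exact: num_real|move=> x cx z _ /=; exact: ltW].
rewrite integral_cst// q1 mule1 EFinD -sumEFin; congr (_ + _)%E.
rewrite integral_sum//; last first.
  move=> i; under eq_fun do rewrite EFinM.
  by apply: integrableZl => //; exact: indic_integrable.
apply: eq_bigr => i _; under eq_integral do rewrite EFinM.
rewrite integralZl//; last exact: indic_integrable.
by rewrite integral_indic// setIT EFinM fineK// prob_fin.
Qed.

(** The negative of a step function below [f] lies above [- f], so monotonicity of contents on step
    functions applies. *)
Lemma fa_int_opp_le (g : set Z -> R) f : fa_content g -> Cb f ->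
  (fa_int g (fun z => - f z)%R <= - fa_int g f)%E.
Proof.
move=> cg Cf; rewrite leeNr; apply: ge_ereal_sup => _ [n [a [A [UA hA ->]]]].
rewrite leeNr -EFinN -[X in (X)%:E]add0r -sumrN.
under eq_bigr do rewrite -mulNr.
apply: fa_int_le => // z; rewrite add0r; under eq_bigr do rewrite mulNr.
by rewrite sumrN lerN2.
Qed.

Lemma Cb_opp f : Cb f -> Cb (fun z => - f z).
Proof.
move=> [cf [M fM]]; split; first by move=> z; apply: cvgN; exact: cf.
by exists M => z; rewrite normrN.
Qed.

(** One staircase bounds [f] from below for [g] and, raised by [eps], from above for [q]. Its
    coefficients are nonnegative, so the comparison of superlevel sets can be summed. *)
Lemma integral_le_fa_int (g : set Z -> R) q f : fa_content g -> q setT = 1%E -> Cb f ->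
  (forall t, (q [set z | (t < f z)%R] <= (g [set z | (t < f z)%R])%:E)%E) ->
  (\int[q]_z (f z)%:E <= fa_int g f)%E.
Proof.
move=> cg q1 Cf qg; have [cf [M fM]] := Cf.
apply/lee_addgt0Pr => eps e0.
have [n [d [t [d0 h1 h2]]]] := staircase fM e0.
have UA i : @Ualg R Z [set z | t i < f z] by exact: Ualg_gt.
apply: (@le_trans _ _ (\int[q]_z (eps - M + \sum_(i < n) d * \1_[set z | t i < f z] z)%:E)%E).
  apply: le_integral => //.
  - exact: Cb_integrable.
  - by apply: simple_integrable => // i; exact: Ualg_Borel.
  - by move=> z _; rewrite lee_fin.
rewrite integral_simple//; last by move=> i; exact: Ualg_Borel.
apply: le_trans (leeD2r eps%:E (fa_int_ge cg UA h1)).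
rewrite -EFinD lee_fin [leRHS]addrC addrA lerD2l ler_sum// => i _.
rewrite ler_wpM2l//; have := qg (t i).
by rewrite -[X in (X <= _)%E]fineK ?lee_fin// prob_fin//; exact: Ualg_Borel.
Qed.

(* Domination of superlevel sets suffices because it also applies to [- f]. *)
Lemma integral_eq_fa_int (g : set Z -> R) q f : fa_content g -> q setT = 1%E -> Cb f ->
  (forall (h : Z -> R) t, continuous h -> (q [set z | (t < h z)%R] <= (g [set z | (t < h z)%R])%:E)%E) ->
  (fa_int g f = \int[q]_z (f z)%:E)%E.
Proof.
move=> cg q1 Cf qg; apply/eqP; rewrite eq_le integral_le_fa_int//; last first.
  by move=> t; apply: qg; case: Cf.
rewrite andbT.
have CNf := Cb_opp Cf.
have := @integral_le_fa_int g q _ cg q1 CNf (fun t => qg _ t CNf.1).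
move=> /le_trans /(_ (fa_int_opp_le cg Cf)).
under eq_integral do rewrite EFinN.
rewrite integralN ?leeN2//.
exact: integrable_add_def (Cb_integrable q1 Cf).
Qed.

Lemma fa_int_prob q f : q setT = 1%E -> Cb f ->
  (fa_int (fun A => fine (q A)) f = \int[q]_z (f z)%:E)%E.
Proof.
move=> q1 Cf; apply: integral_eq_fa_int => //; first exact: prob_content.
by move=> h t ch; rewrite fineK// prob_fin//; apply: Ualg_Borel; exact: (@Ualg_gt R).
Qed.

End integral_content.

(** * Separation of compact sets from closed sets *)

(** Complete regularity in a form ready for use: singletons are compact, and conversely finitely
    many bumps at points combine into one around a compact set. *)
Definition compact_open_separated (R : realType) (Z : topologicalType) :=
  forall K U : set Z, compact K -> open U -> K `<=` U ->
    exists h : Z -> R, [/\ continuous h, (forall z, 0 <= h z <= 1),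
      (forall z, K z -> h z = 1) & (forall z, ~ U z -> h z = 0)].

Section separation.
Context {R : realType}.

Lemma point_compact_open_separated (Z : ptopologicalType) :
  (forall (z : Z) (U : set Z), open U -> U z ->
    exists h : Z -> R, [/\ continuous h, (forall x, 0 <= h x <= 1),
      h z = 1 & (forall x, ~ U x -> h x = 0)]) ->
  compact_open_separated R Z.
Proof.
move=> sep K U cK oU KU.
have /choice[h hP] : forall z, exists h : Z -> R, U z ->
    [/\ continuous h, (forall x, 0 <= h x <= 1), h z = 1 & (forall x, ~ U x -> h x = 0)].
  move=> z; have [Uz|nUz] := pselect (U z); last by exists (cst 0).
  by have [h hP] := sep _ _ oU Uz; exists h.
(* On each set of the cover the bump exceeds 1/2, so twice a finite sum of bumps is at least 1 on
   [K]; truncation at 1 then gives exactly 1 there. *)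
move: cK; rewrite compact_cover => /(_ Z K (fun z => [set x | 1 < 2 * h z x])).
case=> [z Kz|z Kz|D DK KD].
- have [ch _ _ _] := hP _ (KU _ Kz).
  have -> : [set x | 1 < 2 * h z x] = h z @^-1` `]2^-1, +oo[.
    by apply/seteqP; split=> x /=; rewrite in_itv/= andbT -ltr_pdivrMl// mulr1.
  by apply: open_comp; [move=> x _; exact: ch|exact: interval_open].
- exists z => //=; have [_ _ -> _] := hP _ (KU _ Kz).
  by rewrite mulr1 ltr1n.
have hD i : i \in D -> [/\ continuous (h i), (forall x, 0 <= h i x <= 1) &
    (forall x, ~ U x -> h i x = 0)].
  by move=> /DK/set_mem/KU/hP[].
exists (fun x => Num.min 1 (2 * \sum_(i <- D | i \in D) h i x)); split.
- move=> x; apply: (@continuous_min _ _ (cst 1) (fun x => 2 * _)); first exact: cst_continuous.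
  apply: (@cvgM _ _ _ _ (cst 2)); first exact: cvg_cst.
  apply: (@cvg_big _ _ +%R) => [[a b]|i /hD[ch _ _]]; last exact: ch.
  exact: add_continuous.
- move=> x; rewrite ge_min lexx/= andbT le_min ler01/= mulr_ge0//.
  by apply: sumr_ge0 => i /hD[_ /(_ x)/andP[]].
- move=> x /KD[z /= Dz hz]; apply/min_idPl; apply: (le_trans (ltW hz)).
  rewrite ler_wpM2l// (big_rem z)//= Dz lerDl.
  by apply: sumr_ge0 => i /hD[_ /(_ x)/andP[]].
- move=> x nUx; rewrite big1 ?mulr0 ?min_r//.
  by move=> i /hD[_ _ ->].
Qed.

Lemma compact_open_separated_point (Z : topologicalType) (z : Z) (U : set Z) :
  compact_open_separated R Z -> open U -> U z ->
  exists h : Z -> R, [/\ continuous h, (forall x, 0 <= h x <= 1),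
      h z = 1 & (forall x, ~ U x -> h x = 0)].
Proof.
move=> sep oU Uz; have [|h [ch h01 h1 h0]] := sep [set z] U (@compact_set1 _ z) oU.
  by move=> _ ->.
by exists h; split => //; exact: h1.
Qed.

Lemma normal_compact_open_separated (Z : topologicalType) :
  normal_space Z -> hausdorff_space Z -> compact_open_separated R Z.
Proof.
move=> nZ hZ K U cK oU KU.
have /(@uniform_separatorP _ R)[h [ch h01 h0 h1]] : uniform_separator (~` U) K.
  apply: (proj1 (@normal_separatorP R Z) nZ).
  - by rewrite closedC.
  - exact: compact_closed.
  - by rewrite setIC; apply/disjoints_subset; rewrite setCK.
exists h; split=> // z.
- by have /= := h01 (h z) (ex_intro2 _ _ z I erefl); rewrite in_itv.
- by move=> Kz; apply: h1; exists z.
- by move=> nUz; apply: h0; exists z.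
Qed.

Lemma prod_compact_open_separated (X Y : ptopologicalType) :
  compact_open_separated R X -> compact_open_separated R Y ->
  compact_open_separated R (X * Y)%type.
Proof.
move=> sX sY; apply: point_compact_open_separated => -[x y] U oU Uxy.
have /nbhs_interior := open_nbhs_nbhs (conj oU Uxy).
case=> -[A B] /= []; rewrite !nbhsE => -[A' [oA' Ax] AA'] [B' [oB' By] BB'] ABU.
have [h [ch h01 h1 h0]] := compact_open_separated_point sX oA' Ax.
have [k [ck k01 k1 k0]] := compact_open_separated_point sY oB' By.
exists (fun z => h z.1 * k z.2); split.
- move=> z; apply: cvgM.
    by apply: (cvg_comp fst h); [exact: cvg_fst|exact: ch].
  by apply: (cvg_comp snd k); [exact: cvg_snd|exact: ck].
- move=> z; have /andP[? ?] := h01 z.1; have /andP[? ?] := k01 z.2.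
  by rewrite mulr_ge0//= mulr_ile1.
- by rewrite /= h1 k1 mulr1.
- move=> z nUz; have [Az|nAz] := pselect (A' z.1); last by rewrite h0// mul0r.
  have [Bz|nBz] := pselect (B' z.2); last by rewrite k0// mulr0.
  case: nUz; case: z Az Bz => a b /= Az Bz.
  by apply: nbhs_singleton; apply: (ABU (a, b)); split; [exact: AA'|exact: BB'].
Qed.

Lemma hausdorff_prod (X Y : topologicalType) :
  hausdorff_space X -> hausdorff_space Y -> hausdorff_space (X * Y)%type.
Proof.
move=> hX hY [a b] [c d] cl; congr pair.
- apply: hX => A B aA cB.
  have [||[x y] [/= ? ?]] := cl (fst @^-1` A) (fst @^-1` B).
  + exact: (@cvg_fst _ _ (nbhs a) (nbhs b)).
  + exact: (@cvg_fst _ _ (nbhs c) (nbhs d)).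
  by exists x.
- apply: hY => A B aA cB.
  have [||[x y] [/= ? ?]] := cl (snd @^-1` A) (snd @^-1` B).
  + exact: (@cvg_snd _ _ (nbhs a) (nbhs b)).
  + exact: (@cvg_snd _ _ (nbhs c) (nbhs d)).
  by exists y.
Qed.

End separation.

(** * The Radon measure of a tight content *)

(** The Carathéodory measure lives on its own type of points; pushing it forward along the identity,
    measurable because open sets are Carathéodory, moves it to [Borel Z] with the same values. *)
Lemma borel_measure_of_outer (R : realType) (Z : ptopologicalType)
    (m : {outer_measure set Z -> \bar R}) :
  (forall U : set Z, open U -> m.-caratheodory U) ->
  exists p : {measure set (Borel Z) -> \bar R}, forall A, p A = m A.
Proof.
move=> mU; pose f : caratheodory_type m -> Borel Z := id.
have mf : measurable_fun setT f.
  apply: (measurability _ (erefl (@measurable _ (Borel Z)))).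
  by move=> _ [U oU <-]; rewrite setTI; exact: mU.
by exists (measure_function_pushforward__canonical__measure_function_Measure
  (m : {measure set (caratheodory_type m) -> \bar R}) mf).
Qed.

Section radon_outer.
Context {R : realType} {Z : ptopologicalType}.
Variable g : set Z -> R.
Hypothesis cg : fa_content g.
Hypothesis sepZ : compact_open_separated R Z.
Hypothesis tight : forall eps : R, 0 < eps -> exists K : set Z, compact K /\
  forall F, @zero_set R Z F -> F `&` K = set0 -> g F <= eps.

Local Notation zero_set := (@zero_set R Z).
Local Notation Ualg := (@Ualg R Z).
Local Open Scope ereal_scope.

Definition inner_content (U : set Z) : \bar R :=
  ereal_sup [set (g F)%:E | F in [set F | zero_set F /\ F `<=` U]].

Local Notation lam := inner_content.

Lemma inner_content_ge F U : zero_set F -> F `<=` U -> (g F)%:E <= lam U.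
Proof. by move=> zF FU; apply: ereal_sup_ubound; exists F. Qed.

Lemma inner_content_ge0 U : 0 <= lam U.
Proof. have -> : 0 = (g set0)%:E by rewrite content0.
by apply: inner_content_ge => //; exact: zero_set0. Qed.

Lemma inner_content_le_content (U : set Z) : Ualg U -> lam U <= (g U)%:E.
Proof.
move=> UU; apply: ge_ereal_sup => _ [F [zF FU] <-]; rewrite lee_fin.
exact: (content_le cg (Ualg_zero zF) UU FU).
Qed.

Lemma inner_content_le (U V : set Z) : U `<=` V -> lam U <= lam V.
Proof.
move=> UV; apply: le_ereal_sup => _ [F [zF FU] <-]; exists F => //; split=> //.
exact: subset_trans UV.
Qed.

Lemma inner_content_fin (U : set Z) : lam U \is a fin_num.
Proof.
rewrite ge0_fin_numE ?inner_content_ge0//.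
apply: le_lt_trans (inner_content_le (@subsetT _ U)) _.
by apply: le_lt_trans (inner_content_le_content UalgT) _; exact: ltry.
Qed.

Lemma inner_content_approx (U : set Z) (e : R) : (0 < e)%R ->
  exists F, [/\ zero_set F, F `<=` U & lam U <= (g F + e)%:E].
Proof.
move=> e0; have [_ [F [zF FU] <-] h] := ub_ereal_sup_adherent e0 (inner_content_fin U).
exists F; split=> //; rewrite EFinD -leeBlDr//; exact: ltW.
Qed.

(* The pieces of [F] inside each [U i] are peeled off one at a time. *)
Lemma content_peel (K : set Z) (d : R) :
  compact K -> (forall F, zero_set F -> F `&` K = set0 -> (g F <= d)%R) ->
  forall n (U : nat -> set Z), (forall i, open (U i)) -> forall F, zero_set F ->
  F `&` K `<=` \bigcup_(i < n) U i ->
  (g F)%:E <= \sum_(i < n) lam (U i) + d%:E.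
Proof.
move=> cK Kd n U oU; elim: n => [|n IH] F zF FK.
  rewrite big_ord0 add0e lee_fin; apply: Kd => //.
  by apply/seteqP; split=> // z /FK[].
pose C := F `&` K `\` \bigcup_(i < n) U i.
have oUn : open (\bigcup_(i < n) U i) by apply: bigcup_open => i _; exact: oU.
have cC : compact C.
  rewrite /C setDE -setIA setIC -setIA; apply: compact_closedI => //.
  by apply: closedI; [rewrite closedC|exact: zero_set_closed zF].
have CU : C `<=` U n.
  move=> z [/FK[i /= + Uz] nU]; rewrite ltnS leq_eqVlt => /predU1P[<-//|ni].
  by exfalso; apply: nU; exists i.
have [h [ch h01 h1 h0]] := sepZ cC (oU n) CU.
(* The bump is 1 on [C] and 0 off [U n]. Cutting at 1/2 gives zero-sets covering [F]: [F1] lies in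
   [U n], and [F2] avoids [C], so that [F2] meets [K] only inside the first [n] open sets. *)
pose F1 := F `&` [set z | (2^-1 <= h z)%R]; pose F2 := F `&` [set z | (h z <= 2^-1)%R].
have zF1 : zero_set F1 by apply: zero_setI => //; exact: zero_set_ge.
have zF2 : zero_set F2 by apply: zero_setI => //; exact: zero_set_le.
have FE : F = F1 `|` F2.
  rewrite -setIUr; apply/esym/setIidPl => z _ /=.
  by case: (leP 2^-1 (h z))%R => [|/ltW]; [left|right].
have half0 : (0 < 2^-1 :> R)%R by rewrite invr_gt0.
have g1 : (g F1)%:E <= lam (U n).
  apply: inner_content_ge => // z [Fz /= hz]; apply: contrapT => /h0 h0z.
  by move: hz; rewrite h0z leNgt half0.
have g2 : (g F2)%:E <= \sum_(i < n) lam (U i) + d%:E.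
  apply: IH => // z [[Fz /= hz] Kz]; apply: contrapT => nU.
  have : h z = 1%R by apply: h1; split.
  by move: hz => /[swap] ->; rewrite leNgt invf_lt1// ltr1n.
rewrite big_ord_recr/= addeAC; apply: le_trans (leeD g2 g1).
rewrite -EFinD lee_fin addrC FE; apply: content_leU => //; exact: Ualg_zero.
Qed.

(** A zero-set [F] inside the union meets the tightness compact [K] in a compact set, so finitely
    many [U i] suffice there; the part of [F] away from [K] costs at most [e]. *)
Lemma inner_content_sigma (U : nat -> set Z) : (forall i, open (U i)) ->
  lam (\bigcup_i U i) <= \sum_(i <oo) lam (U i).
Proof.
move=> oU; apply: ge_ereal_sup => _ [F [zF FU] <-].
apply/lee_addgt0Pr => e e0; have [K [cK Ke]] := tight e0.
have cFK : compact (F `&` K).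
  by rewrite setIC; apply: compact_closedI => //; exact: zero_set_closed zF.
move: cFK; rewrite compact_cover => /(_ nat setT U).
case=> [i _|z [Fz _]|D _ FD]; [exact: oU|exact: FU|].
pose n := (\max_(i <- D) i).+1.
have {}FD : F `&` K `<=` \bigcup_(i < n) U i.
  move=> z /FD[i /= Di Uz]; exists i => //=; rewrite /n ltnS.
  exact: (@leq_bigmax_seq _ _ xpredT id).
apply: le_trans (content_peel cK Ke oU zF FD) _; rewrite leeD2r//.
rewrite -(big_mkord xpredT (fun i => lam (U i))).
apply: nneseries_lim_ge => i _ _; exact: inner_content_ge0.
Qed.

Definition radon_outer (A : set Z) : \bar R :=
  ereal_inf [set lam U | U in [set U | open U /\ A `<=` U]].

Lemma radon_outer_le A U : open U -> A `<=` U -> radon_outer A <= lam U.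
Proof. by move=> oU AU; apply: ereal_inf_lbound; exists U. Qed.

Lemma radon_outer_open U : open U -> radon_outer U = lam U.
Proof.
move=> oU; apply/eqP; rewrite eq_le radon_outer_le//=.
by apply: le_ereal_inf_tmp => _ [V [oV UV] <-]; exact: inner_content_le.
Qed.

Lemma radon_outer_ge0 A : 0 <= radon_outer A.
Proof. by apply: le_ereal_inf_tmp => _ [V _ <-]; exact: inner_content_ge0. Qed.

Lemma radon_outer0 : radon_outer set0 = 0.
Proof.
apply/eqP; rewrite eq_le radon_outer_ge0 andbT radon_outer_open//; last exact: open0.
have -> : 0 = (g set0)%:E by rewrite content0.
by apply: inner_content_le_content; exact: Ualg0.
Qed.

Lemma le_radon_outer : {homo radon_outer : A B / A `<=` B >-> A <= B}.
Proof.
move=> A B AB; apply: le_ereal_inf_tmp => _ [V [oV BV] <-].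
by apply: radon_outer_le => //; exact: subset_trans BV.
Qed.

Lemma radon_outer_fin A : radon_outer A \is a fin_num.
Proof.
rewrite ge0_fin_numE ?radon_outer_ge0//.
apply: le_lt_trans (radon_outer_le openT (@subsetT _ A)) _.
by rewrite -ge0_fin_numE ?inner_content_ge0// inner_content_fin.
Qed.

Lemma radon_outer_approx A (e : R) : (0 < e)%R ->
  exists U, [/\ open U, A `<=` U & lam U <= radon_outer A + e%:E].
Proof.
move=> e0; have [_ [U [oU AU] <-] h] := lb_ereal_inf_adherent e0 (radon_outer_fin A).
by exists U; split => //; exact: ltW.
Qed.

Lemma radon_outer_sigma_subadditive : sigma_subadditive radon_outer.
Proof.
move=> A; apply/lee_addgt0Pr => e e0.
have /choice[U UP] : forall n, exists U, [/\ open U, A n `<=` U &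
    lam U <= radon_outer (A n) + (e / (2 ^ n.+1)%:R)%:E].
  by move=> n; apply: radon_outer_approx; rewrite divr_gt0// ltr0n expn_gt0.
have oU n : open (U n) by case: (UP n).
apply: (@le_trans _ _ (lam (\bigcup_i U i))).
  apply: radon_outer_le; first by apply: bigcup_open => i _; exact: oU.
  by move=> z [i _ Az]; exists i => //; case: (UP i) => _ AU _; exact: AU.
apply: le_trans (inner_content_sigma oU) _.
apply: (@le_trans _ _ (\sum_(n <oo) (radon_outer (A n) + (e / (2 ^ n.+1)%:R)%:E))).
  apply: lee_nneseries => [i|i] *; first exact: inner_content_ge0.
  by case: (UP i).
by apply: epsilon_trick => [n|]; [exact: radon_outer_ge0|exact: ltW].
Qed.

HB.instance Definition _ := isOuterMeasure.Build R Z radon_outer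
  radon_outer0 radon_outer_ge0 le_radon_outer radon_outer_sigma_subadditive.

Lemma open_caratheodory U : open U -> radon_outer.-caratheodory U.
Proof.
move=> oU; apply: le_caratheodory_measurable => A.
apply: le_ereal_inf_tmp => _ [W [oW AW] <-].
apply/lee_addgt0Pr => e e0; have e20 : (0 < e / 2)%R by rewrite divr_gt0.
have [F1 [zF1 F1W lF1]] := inner_content_approx (W `&` U) e20.
(* Exhausting [W] minus [F1] rather than [W] minus [U] keeps the set open. It still contains the
   part of [A] outside [U], and it makes [F2] disjoint from [F1], so that [g] adds. *)
have [F2 [zF2 F2W lF2]] := inner_content_approx (W `\` F1) e20.
have oWF : open (W `\` F1).
  by rewrite setDE; apply: openI => //; rewrite openC; exact: zero_set_closed zF1.
have h1 : radon_outer (A `&` U) <= (g F1 + e / 2)%:E.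
  apply: le_trans lF1; apply: radon_outer_le; first exact: openI.
  by move=> z [/AW]; split.
have h2 : radon_outer (A `&` ~` U) <= (g F2 + e / 2)%:E.
  apply: le_trans lF2; apply: radon_outer_le => // z [/AW Wz nUz].
  by split => // /F1W[].
apply: le_trans (leeD h1 h2) _.
have -> : ((g F1 + e / 2)%:E + (g F2 + e / 2)%:E = (g (F1 `|` F2))%:E + e%:E).
  rewrite (contentU cg) ?EFinD; [|exact: Ualg_zero..|].
    by rewrite -!EFinD; congr EFin; lra.
  by apply/seteqP; split => // z [F1z /F2W[]].
rewrite leeD2r//; apply: inner_content_ge; first exact: zero_setU.
by move=> z [/F1W[]|/F2W[]].
Qed.

Lemma exists_radon_outer_measure :
  exists p : {measure set (Borel Z) -> \bar R}, forall A, p A = radon_outer A.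
Proof. exact: (@borel_measure_of_outer R Z radon_outer) open_caratheodory. Qed.

End radon_outer.

(** * The Radon probability representing a tight content *)

Section exists_radon.
Context {R : realType} {Z : ptopologicalType}.
Variable g : set Z -> R.
Hypothesis cg : fa_content g.
Hypothesis hZ : hausdorff_space Z.
Hypothesis sepZ : compact_open_separated R Z.
Hypothesis tight : forall eps : R, 0 < eps -> exists K : set Z, compact K /\
  forall F, @zero_set R Z F -> F `&` K = set0 -> g F <= eps.

Lemma exists_radon_prob : exists p : {measure set (Borel Z) -> \bar R},
  radon_prob p /\ forall f, Cb f -> (fa_int g f = \int[p]_z (f z)%:E)%E.
Proof.
have [p pE] := exists_radon_outer_measure cg sepZ tight.
have pU U : open U -> p U = inner_content g U.
  by move=> oU; rewrite pE; exact: radon_outer_open.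
have p1 : p setT = 1%E.
  rewrite pU; last exact: openT.
  apply/eqP; rewrite eq_le; apply/andP; split.
    by rewrite -(contentT cg); apply: (inner_content_le_content cg); exact: UalgT.
  by rewrite -(contentT cg); apply: inner_content_ge => //; exact: zero_setT.
exists p; split; last first.
  move=> f Cf; apply: integral_eq_fa_int => // h t ch.
  rewrite pU; last first.
    have -> : [set z | t < h z] = h @^-1` `]t, +oo[.
      by apply/seteqP; split=> x /=; rewrite in_itv/= andbT.
    by apply: open_comp; [move=> x _; exact: ch|exact: interval_open].
  by apply: inner_content_le_content => //; exact: Ualg_gt.
split=> // B mB eps e0.
have e20 : 0 < eps / 2 by rewrite divr_gt0.
have e40 : 0 < eps / 2 / 2 by rewrite divr_gt0.
have [K [cK Ke]] := tight e20.
have [U [oU BU hU]] := radon_outer_approx cg (~` B) e40.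
have cC : closed (~` U) by rewrite closedC.
(* The complement of [U] is closed, inside [B], and misses at most [eps / 4] of it; intersecting
   with [K] loses at most [eps / 2] more. The total stays strictly below [eps]. *)
exists (K `&` ~` U); split.
- exact: compact_closedI.
- by move=> z [_ nUz]; apply: contrapT => nBz; apply: nUz; exact: BU.
have mU := Borel_open oU.
have mK : measurable (K : set (Borel Z)) by apply: Borel_closed; exact: compact_closed.
have mBC : measurable (~` B : set (Borel Z)) by exact: measurableC.
have hK : (p (~` K) <= (eps / 2)%:E)%E.
  rewrite pU; last by rewrite openC; exact: compact_closed.
  apply: ge_ereal_sup => _ [F [zF FK] <-]; rewrite lee_fin; apply: Ke => //.
  by apply/seteqP; split=> // z [/FK].
have hUB : (p (U `\` ~` B) <= (eps / 2 / 2)%:E)%E.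
  rewrite measureD//; last by rewrite (le_lt_trans (prob_le1 p1 mU))// ltry.
  rewrite (setIidr BU) leeBlDl; last exact: prob_fin.
  by rewrite -(pU _ oU) -pE in hU.
apply: (@le_lt_trans _ _ (p (~` K `|` (U `\` ~` B)))).
  apply: le_measure.
  - apply/mem_set; apply: measurableD => //; apply: measurableI => //; exact: measurableC.
  - by apply/mem_set; apply: measurableU; [exact: measurableC|exact: measurableD].
  move=> z [Bz nKU]; have [Kz|nKz] := pselect (K z); last by left.
  right; split; last by apply.
  by apply: contrapT => nUz; apply: nKU.
apply: le_lt_trans (measureU2 _ _ _) _.
- exact: measurableC.
- exact: measurableD.
apply: le_lt_trans (leeD hK hUB) _.
by rewrite -EFinD lte_fin; lra.
Qed.

End exists_radon.

(** * Radon probabilities are determined by bounded continuous functions *)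

Section marginals.
Context {R : realType} {X : ptopologicalType}.
Implicit Types (m : {measure set (Borel X) -> \bar R}).

Lemma integral_indic_le m (A : set X) (f : X -> R) :
  m setT = 1%E -> measurable (A : set (Borel X)) -> Cb f ->
  (forall x, \1_A x <= f x) -> (m A <= \int[m]_x (f x)%:E)%E.
Proof.
move=> m1 mA Cf Af; have <- : (\int[m]_x (\1_A x : R)%:E = m A)%E by rewrite integral_indic// setIT.
apply: le_integral => //; [exact: indic_integrable|exact: Cb_integrable|].
by move=> x _; rewrite lee_fin.
Qed.

Lemma integral_le_indic m (A : set X) (f : X -> R) :
  m setT = 1%E -> measurable (A : set (Borel X)) -> Cb f ->
  (forall x, f x <= \1_A x) -> (\int[m]_x (f x)%:E <= m A)%E.
Proof.
move=> m1 mA Cf Af; have <- : (\int[m]_x (\1_A x : R)%:E = m A)%E by rewrite integral_indic// setIT.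
apply: le_integral => //; [exact: Cb_integrable|exact: indic_integrable|].
by move=> x _; rewrite lee_fin.
Qed.

Lemma radon_sup_compact m (U : set X) (x : \bar R) :
  hausdorff_space X -> radon_prob m -> open U ->
  (forall K : set X, compact K -> K `<=` U -> (m K <= x)%E) -> (m U <= x)%E.
Proof.
move=> hX [m1 mr] oU h; apply/lee_addgt0Pr => e e0.
have mU := Borel_open oU.
have [K [cK KU hK]] := mr _ mU _ e0.
have mK : measurable (K : set (Borel X)) by apply: Borel_closed; exact: compact_closed.
apply: (@le_trans _ _ (m K + e%:E)%E); last by rewrite leeD2r// h.
rewrite -(setDUK KU) (le_trans (measureU2 _ _ _))//; first exact: measurableD.
by rewrite leeD2l//; exact: ltW.
Qed.

(** For [K] compact inside [U] open, a bump between the two indicators compares the measure of [K]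
    under one with that of [U] under the other. Inner regularity then settles open sets, which form
    a generating class stable under intersection. The inequality on C_b reverses under [- f], so one
    direction is enough. *)
Lemma radon_prob_unique m1 m2 : hausdorff_space X -> compact_open_separated R X ->
  radon_prob m1 -> radon_prob m2 ->
  (forall f, Cb f -> (\int[m1]_x (f x)%:E <= \int[m2]_x (f x)%:E)%E) ->
  forall A, measurable A -> m1 A = m2 A.
Proof.
move=> hX sX r1 r2 h12.
have key (n1 n2 : {measure set (Borel X) -> \bar R}) : radon_prob n1 -> radon_prob n2 ->
    (forall f, Cb f -> (\int[n1]_x (f x)%:E <= \int[n2]_x (f x)%:E)%E) ->
    forall U : set X, open U -> (n1 U <= n2 U)%E.
  move=> q1 q2 h U oU; apply: radon_sup_compact => // K cK KU.
  have [k [ck k01 k1 k0]] := sX _ _ cK oU KU.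
  have Ck : Cb k.
    split=> //; exists 1 => x; have /andP[? ?] := k01 x.
    by rewrite ger0_norm.
  apply: (@le_trans _ _ (\int[n1]_x (k x)%:E)%E).
    apply: integral_indic_le => //; first by case: q1.
      by apply: Borel_closed; exact: compact_closed.
    move=> x; rewrite indicE; have [/set_mem Kx|_] := boolP (x \in K).
      by rewrite k1.
    by case/andP: (k01 x).
  apply: (le_trans (h _ Ck)); apply: integral_le_indic => //; first by case: q2.
    exact: Borel_open.
  move=> x; rewrite indicE; have [_|nUx] := boolP (x \in U).
    by case/andP: (k01 x).
  by rewrite k0// => /mem_set; exact/negP.
have h21 f : Cb f -> (\int[m2]_x (f x)%:E <= \int[m1]_x (f x)%:E)%E.
  move=> Cf; have := h12 _ (Cb_opp Cf).
  under eq_integral do rewrite EFinN.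
  under [in X in (_ <= X)%E -> _]eq_integral do rewrite EFinN.
  rewrite !integralN ?leeN2//; apply: integrable_add_def => //.
  - by apply: Cb_integrable => //; case: r2.
  - by apply: Cb_integrable => //; case: r1.
have E U : open U -> m1 U = m2 U.
  by move=> oU; apply/eqP; rewrite eq_le !key.
have r11 := r1.1; have r21 := r2.1.
move=> A mA; apply: (@measure_unique _ _ (Borel X) (@open X) (fun=> setT)) => //.
- by move=> U V; exact: openI.
- by move=> _; exact: openT.
- by rewrite bigcup_const.
- by move=> _; rewrite r11 ltry.
Qed.

End marginals.

(** * Images and regularity on the zero-set algebra *)

Section maps.
Context {R : realType} {X Y : ptopologicalType}.
Implicit Types (p : {measure set (Borel X) -> \bar R}).

Lemma continuous_Borel_map (f : X -> Y) :
  continuous f -> measurable_fun setT (f : Borel X -> Borel Y).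
Proof.
move=> cf; apply: (measurability _ (erefl (@measurable _ (Borel Y)))).
move=> _ [U oU <-]; rewrite setTI; apply: Borel_open.
by apply: open_comp => // x _; exact: cf.
Qed.

Lemma preimage_Borel (f : X -> Y) (A : set (Borel Y)) :
  continuous f -> measurable A -> measurable (f @^-1` A : set (Borel X)).
Proof.
by move=> cf mA; rewrite -[X in measurable X]setTI; exact: continuous_Borel_map.
Qed.

Lemma Cb_comp (f : X -> Y) (h : Y -> R) : continuous f -> Cb h -> Cb (h \o f).
Proof.
move=> cf [ch [M hM]]; split; last by exists M => x; exact: hM.
by move=> x; apply: continuous_comp; [exact: cf|exact: ch].
Qed.

Lemma exists_pushforward p (f : X -> Y) : p setT = 1%E -> continuous f ->
  exists q : {measure set (Borel Y) -> \bar R},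
    (forall A, q A = p (f @^-1` A)) /\
    (forall h, Cb h -> (\int[q]_y (h y)%:E = \int[p]_x (h (f x))%:E)%E).
Proof.
move=> p1 cf; have mf := continuous_Borel_map cf.
exists (measure_function_pushforward__canonical__measure_function_Measure p mf).
split=> // h Ch; rewrite integral_pushforward//=.
- by apply/measurable_EFinP; apply: continuous_Borel; case: Ch.
- by rewrite preimage_setT; exact: (Cb_integrable p1 (Cb_comp cf Ch)).
Qed.

Lemma radon_prob_pushforward p (q : {measure set (Borel Y) -> \bar R}) (f : X -> Y) :
  hausdorff_space Y -> continuous f -> (forall A, q A = p (f @^-1` A)) ->
  hausdorff_space X -> radon_prob p -> radon_prob q.
Proof.
move=> hY cf qE hX [p1 pr]; split; first by rewrite qE preimage_setT.
move=> B mB eps e0; have mfB := preimage_Borel cf mB.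
have [K [cK KB pK]] := pr _ mfB _ e0.
have cfK : compact (f @` K).
  by apply: continuous_compact => //; exact: continuous_subspaceT.
exists (f @` K); split => //; first by move=> _ [x Kx <-]; exact: KB.
apply: le_lt_trans pK; rewrite qE; apply: le_measure.
- apply/mem_set; apply: preimage_Borel => //; apply: measurableD => //.
  by apply: Borel_closed; exact: compact_closed.
- apply/mem_set; apply: measurableD => //.
  by apply: Borel_closed; exact: compact_closed.
- by move=> x [Bx nK]; split => // Kx; apply: nK; exists x.
Qed.

Lemma prob_regular p (A : set X) (eps : R) : p setT = 1%E -> @Ualg R X A -> 0 < eps ->
  exists F, [/\ @zero_set R X F, F `<=` A & fine (p (A `\` F)) < eps].
Proof.
move=> p1 UA e0.
pose ir (A : set X) := forall eps : R, 0 < eps ->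
  exists F, [/\ @zero_set R X F, F `<=` A & (p (A `\` F) < eps%:E)%E].
(* Inner approximation is demanded of a set and of its complement, which makes the class stable
   under complements. *)
pose M := [set A : set X | [/\ measurable (A : set (Borel X)), ir A & ir (~` A)]].
have mz F : @zero_set R X F -> measurable (F : set (Borel X)).
  by move=> zF; apply: Borel_closed; exact: zero_set_closed zF.
have p_union (A1 A2 F1 F2 D : set X) (e : R) :
    measurable (A1 : set (Borel X)) -> measurable (A2 : set (Borel X)) ->
    measurable (D : set (Borel X)) ->
    @zero_set R X F1 -> @zero_set R X F2 ->
    (p (A1 `\` F1) < (e / 2)%:E)%E -> (p (A2 `\` F2) < (e / 2)%:E)%E ->
    D `<=` (A1 `\` F1) `|` (A2 `\` F2) -> (p D < e%:E)%E.
  move=> m1 m2 mD /mz mF1 /mz mF2 h1 h2 DA.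
  have mA1 : measurable (A1 `\` F1 : set (Borel X)) by exact: measurableD.
  have mA2 : measurable (A2 `\` F2 : set (Borel X)) by exact: measurableD.
  apply: (@le_lt_trans _ _ (p ((A1 `\` F1) `|` (A2 `\` F2)))).
    by apply: le_measure => //; apply/mem_set => //; exact: measurableU.
  apply: le_lt_trans (measureU2 _ mA1 mA2) _.
  by rewrite [e]splitr EFinD lteD.
have algM : set_algebra M.
  split.
  - split; first exact: (@measurable0 _ (Borel X)).
    + move=> e e00; exists set0; split => //; first exact: zero_set0.
      by rewrite setD0 measure0.
    + move=> e e00; exists setT; split; first exact: zero_setT.
        by rewrite setC0.
      by rewrite setDT measure0.
  - move=> B [mB iB iBC]; split => //; last by rewrite setCK.
    exact: (@measurableC _ (Borel X)).
  - move=> B C [mB iB iBC] [mC iC iCC].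
    have mBC := @measurableC _ (Borel X) _ mB; have mCC := @measurableC _ (Borel X) _ mC.
    have mU : measurable (B `|` C : set (Borel X)) by exact: measurableU.
    split => //.
    + move=> e e00; have e20 : 0 < e / 2 by rewrite divr_gt0.
      have [F1 [z1 F1B h1]] := iB _ e20; have [F2 [z2 F2C h2]] := iC _ e20.
      exists (F1 `|` F2); split; [exact: zero_setU|exact: setUSS|].
      apply: (p_union B C F1 F2) => //.
        by apply: (@measurableD _ (Borel X)) => //; apply: mz; exact: zero_setU.
      by move=> z [[?|?] nF]; [left|right]; split => // Fz; apply: nF; [left|right].
    + rewrite setCU => e e00; have e20 : 0 < e / 2 by rewrite divr_gt0.
      have [F1 [z1 F1B h1]] := iBC _ e20; have [F2 [z2 F2C h2]] := iCC _ e20.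
      exists (F1 `&` F2); split; [exact: zero_setI|exact: setISS|].
      apply: (p_union (~` B) (~` C) F1 F2) => //.
        apply: (@measurableD _ (Borel X)); last by apply: mz; exact: zero_setI.
        exact: (@measurableI _ (Borel X)).
      move=> z [[? ?] nF]; have [F1z|nF1z] := pselect (F1 z); last by left.
      by right; split => // F2z; apply: nF.
have zM : @zero_set R X `<=` M.
  move=> F zF; split; first exact: mz.
    by move=> e e00; exists F; split => //; rewrite setDv measure0.
  move=> e e00; have [f [cf FE]] := zF.
  (* These zero-sets increase to the complement of [F]; continuity from above makes the remainder
     tend to 0. *)
  pose G n := [set x | n.+1%:R^-1 <= `|f x|].
  have zG n : @zero_set R X (G n).
    by apply: (@zero_set_ge R X (fun x => `|f x|)) => x; apply: cvg_norm; exact: cf.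
  have mD n : measurable (~` F `\` G n : set (Borel X)).
    apply: (@measurableD _ (Borel X)); last exact: mz.
    by apply: measurableC; exact: mz.
  apply: contrapT => h.
  have {}h n : (e%:E <= p (~` F `\` G n))%E.
    rewrite leNgt; apply/negP => pG; apply: h; exists (G n); split => //.
    move=> x /= Gx Fx; move: Gx; rewrite /G/=; move: Fx; rewrite FE => /= ->.
    by rewrite normr0 leNgt invr_gt0 ltr0n.
  have cap0 : \bigcap_n (~` F `\` G n) = set0.
    apply/seteqP; split => // x xG; have [Fx _] := xG 0%N I.
    have fx0 : 0 < `|f x| by rewrite normr_gt0; apply/eqP => fx; apply: Fx; rewrite FE.
    have [_] := xG (Num.truncn `|f x|^-1) I; apply; rewrite /G/=.
    by rewrite invf_ple ?posrE ?ltr0n//; apply: ltW; exact: truncnS_gt.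
  have : p (~` F `\` G n) @[n --> \oo] --> p (\bigcap_n (~` F `\` G n)).
    apply: nonincreasing_cvg_mu => //.
    - by apply: (le_lt_trans (prob_le1 p1 (mD _))); exact: ltry.
    - by rewrite cap0.
    - move=> m n mn; apply/subsetPset => x [Fx nG]; split=> // Gx; apply: nG.
      apply: le_trans Gx => /=.
      by rewrite lef_pV2 ?posrE ?ltr0n// ler_nat.
  rewrite cap0 measure0 => /cvge_to_ge-/(_ e%:E) H.
  have : (e%:E <= 0)%E by apply: H; exact: nearW.
  by rewrite lee_fin leNgt e00.
have [mA iA _] := UA M (conj algM zM).
have [F [zF FA pF]] := iA _ e0; exists F; split => //.
rewrite -lte_fin fineK// prob_fin//.
by apply: (@measurableD _ (Borel X)) => //; exact: mz.
Qed.

End maps.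

(** The second factor enters only through a filter, so that the tube lemma for two compact sets
    follows from two applications: one with the neighbourhoods of a point and swapped coordinates,
    then one with the neighbourhoods of [L]. *)
Lemma compact_filter_tube (X : ptopologicalType) (Y : Type) (G : set_system Y)
    (K : set X) (U : set (X * Y)) : Filter G -> compact K ->
  (forall x, K x -> exists A B, [/\ nbhs x A, G B & A `*` B `<=` U]) ->
  exists V B, [/\ open V, K `<=` V, G B & V `*` B `<=` U].
Proof.
move=> FG cK h.
have /choice[W WP] : forall x, exists W : set X * set Y, K x ->
    [/\ open W.1, W.1 x, G W.2 & W.1 `*` W.2 `<=` U].
  move=> x; have [Kx|nKx] := pselect (K x); last by exists (set0, set0).
  have [A [B [xA GB AB]]] := h _ Kx.
  exists (A^°, B) => _; split => //=; first exact: open_interior.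
  by move=> [a b] [/= /interior_subset Aa Bb]; exact: AB.
move: cK; rewrite compact_cover => /(_ X K (fun x => (W x).1)).
case=> [x /WP[]//|x Kx|D DK KD]; first by exists x => //; case: (WP _ Kx).
have KDx x : x \in D -> K x by move=> /DK/set_mem.
exists (\bigcup_(x in [set` D]) (W x).1), (\bigcap_(x in [set` D]) (W x).2); split => //.
- by apply: bigcup_open => x /= /KDx/WP[].
- by apply: filter_bigI => x /KDx/WP[].
- move=> [a b] [/= [x Dx Wa] Wb]; have [_ _ _] := WP _ (KDx _ Dx); apply.
  by split => //=; exact: Wb.
Qed.

Lemma compact_tube (X Y : ptopologicalType) (K : set X) (L : set Y) (U : set (X * Y)) :
  compact K -> compact L -> open U -> K `*` L `<=` U ->
  exists V W, [/\ open V, open W, K `<=` V, L `<=` W & V `*` W `<=` U].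
Proof.
move=> cK cL oU KLU.
have [x Kx|V [B [oV KV /set_nbhsP[W [oW LW WB]] VBU]]] :=
    @compact_filter_tube X Y (set_nbhs L) K U _ cK.
- have [y Ly|W [A [oW LW xA WA]]] :=
      @compact_filter_tube Y X (nbhs x) L [set z | U (z.2, z.1)] _ cL.
  + have : nbhs (x, y) U by apply: open_nbhs_nbhs; split => //; exact: KLU.
    move=> [[A B] [/= xA yB] ABU]; exists B, A; split => //.
    by move=> [b a] [/= Bb Aa]; apply: (ABU (a, b)).
  + exists A, W; split => //.
      by apply/set_nbhsP; exists W; split.
    by move=> [a b] [/= Aa Wb]; apply: (WA (b, a)).
- exists V, W; split => //.
  by move=> [a b] [/= Va Wb]; apply: VBU; split => //; exact: WB.
Qed.

Lemma continuous_fst (X Y : topologicalType) : continuous (@fst X Y).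
Proof. by move=> z; exact: cvg_fst. Qed.

Lemma continuous_snd (X Y : topologicalType) : continuous (@snd X Y).
Proof. by move=> z; exact: cvg_snd. Qed.

(** * Transport plans *)

Section plans.
Context {R : realType} {X Y : ptopologicalType}.
Hypothesis hX : hausdorff_space X.
Hypothesis hY : hausdorff_space Y.
Hypothesis sX : compact_open_separated R X.
Hypothesis sY : compact_open_separated R Y.
Variables (mu : {measure set (Borel X) -> \bar R}) (nu : {measure set (Borel Y) -> \bar R}).
Hypothesis rmu : radon_prob mu.
Hypothesis rnu : radon_prob nu.

Lemma Cb_cst (Z : topologicalType) (c : R) : Cb (fun _ : Z => c).
Proof. by split; [exact: cst_continuous|exists `|c|]. Qed.

Lemma integral_fst p (phi : X -> R) : Pi mu nu p -> Cb phi ->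
  (\int[p]_z (phi z.1)%:E = \int[mu]_x (phi x)%:E)%E.
Proof.
move=> [[p1 _] pX _] Cphi; have [q [qE <-//]] := exists_pushforward p1 (@continuous_fst X Y).
apply: eq_measure_integral => A mA _; rewrite qE -pX//.
by congr (p _); apply/seteqP; split => [z|z []].
Qed.

Lemma integral_snd p (psi : Y -> R) : Pi mu nu p -> Cb psi ->
  (\int[p]_z (psi z.2)%:E = \int[nu]_y (psi y)%:E)%E.
Proof.
move=> [[p1 _] _ pY] Cpsi; have [q [qE <-//]] := exists_pushforward p1 (@continuous_snd X Y).
apply: eq_measure_integral => A mA _; rewrite qE -pY//.
by congr (p _); apply/seteqP; split => [z|z []].
Qed.

Lemma Pi_Gamma p : Pi mu nu p -> Gamma mu nu (fun A => fine (p A)).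
Proof.
move=> Pip; have [[p1 _] _ _] := Pip.
have [c0 c1 cU] := prob_content p1.
split; first by split => // A UA eps e0; exact: prob_regular.
move=> phi psi Cphi Cpsi.
have C1 := Cb_comp (@continuous_fst X Y) Cphi; have C2 := Cb_comp (@continuous_snd X Y) Cpsi.
rewrite fa_int_prob//; last first.
  move: C1 C2 => [c1' [M hM]] [c2' [N hN]]; split.
    by move=> z; apply: cvgD; [exact: c1'|exact: c2'].
  exists (M + N) => z; apply: le_trans (ler_normD _ _) _.
  by apply: lerD; [exact: hM|exact: hN].
under eq_integral do rewrite EFinD.
rewrite (integralD _ (Cb_integrable p1 C1) (Cb_integrable p1 C2))//=.
by rewrite integral_fst// integral_snd.
Qed.

(* A bump function around a compact set carrying most of the mass of [m] bounds
   the content of the preimage of the complement. *)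
Lemma content_far_le (Z W : ptopologicalType) (f : W -> Z) (m : {measure set (Borel Z) -> \bar R})
    (g : set W -> R) (K V : set Z) (eps : R) :
  hausdorff_space Z -> compact_open_separated R Z -> m setT = 1%E ->
  continuous f -> fa_content g ->
  (forall h, Cb h -> (fa_int g (h \o f) <= \int[m]_x (h x)%:E)%E) ->
  compact K -> open V -> K `<=` V -> (m (~` K) <= eps%:E)%E ->
  exists F, [/\ @zero_set R W F, f @^-1` (~` V) `<=` F & g F <= eps].
Proof.
move=> hZ sZ m1 cf cg gm cK oV KV mK.
have [h [ch h01 h1 h0]] := sZ _ _ cK oV KV.
pose k z := 1 - h z.
have Ck : Cb k.
  split; first by move=> z; apply: cvgB; [exact: cvg_cst|exact: ch].
  by exists 1 => z; rewrite /k; have /andP[? ?] := h01 z; rewrite ler_norml; lra.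
exists [set w | 1 <= k (f w)].
have zF : @zero_set R W [set w | 1 <= k (f w)].
  by apply: (@zero_set_ge R W (k \o f)); case: (Cb_comp cf Ck).
split => //; first by move=> w /= nV; rewrite /k h0// subr0.
rewrite -lee_fin; apply: le_trans mK.
apply: (@le_trans _ _ (\int[m]_x (k x)%:E)%E); last first.
  apply: integral_le_indic => //.
    by apply: measurableC; apply: Borel_closed; exact: compact_closed.
  move=> x; rewrite indicE; have [xK|] := boolP (x \in ~` K).
    by case/andP: (h01 x) => ? _; rewrite [leRHS]/= /k; lra.
  by rewrite in_setC negbK => /set_mem Kx; rewrite /k h1// subrr.
apply: le_trans (gm _ Ck).
have := @fa_int_ge R W g cg 1 (fun=> 1) (fun=> [set w | 1 <= k (f w)]) 0 (k \o f).
rewrite big_ord1 add0r mul1r; apply; first by move=> _; exact: Ualg_zero.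
move=> w; rewrite add0r big_ord1 mul1r indicE.
have [/set_mem//|_] := boolP (w \in _).
by rewrite /= /k subr_ge0; case/andP: (h01 (f w)).
Qed.

(** Upper bounds on the marginals suffice: they give tightness, and [radon_prob_unique] turns them
    into equality of the marginals. This is what lets the lemma accept ultrafilter limits. *)
Lemma exists_plan (g : set (X * Y) -> R) : fa_content g ->
  (forall phi, Cb phi -> (fa_int g (phi \o fst) <= \int[mu]_x (phi x)%:E)%E) ->
  (forall psi, Cb psi -> (fa_int g (psi \o snd) <= \int[nu]_y (psi y)%:E)%E) ->
  exists p, Pi mu nu p /\ forall f, Cb f -> (fa_int g f = \int[p]_z (f z)%:E)%E.
Proof.
move=> cg g1 g2.
have hXY := hausdorff_prod hX hY.
have sXY := prod_compact_open_separated sX sY.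
have tight : forall eps : R, 0 < eps -> exists K : set (X * Y), compact K /\
    forall F, @zero_set R (X * Y)%type F -> F `&` K = set0 -> g F <= eps.
  move=> eps e0; have e20 : 0 < eps / 2 by rewrite divr_gt0.
  have [K [cK _ mK]] := rmu.2 _ measurableT _ e20.
  have [L [cL _ nL]] := rnu.2 _ measurableT _ e20.
  exists (K `*` L); split; first exact: compact_setX.
  move=> F zF FKL.
  have oF : open (~` F) by rewrite openC; exact: zero_set_closed zF.
  (* An open rectangle around [K] times [L] off [F] forces every point of [F] to have its first
     coordinate outside [V] or its second outside [W]. *)
  have [V [W [oV oW KV LW VWF]]] : exists V W,
      [/\ open V, open W, K `<=` V, L `<=` W & V `*` W `<=` ~` F].
    by apply: compact_tube => // z KLz Fz; have : (F `&` (K `*` L)) z by []; rewrite FKL.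
  rewrite setTD in mK; rewrite setTD in nL.
  have [F1 [z1 VF1 gF1]] := content_far_le hX sX rmu.1 (@continuous_fst X Y) cg g1 cK oV KV (ltW mK).
  have [F2 [z2 WF2 gF2]] := content_far_le hY sY rnu.1 (@continuous_snd X Y) cg g2 cL oW LW (ltW nL).
  rewrite (splitr eps); apply: le_trans (lerD gF1 gF2).
  apply: le_trans (content_leU cg (Ualg_zero z1) (Ualg_zero z2)).
  apply: content_le => //; [exact: Ualg_zero|exact: UalgU (Ualg_zero z1) (Ualg_zero z2)|].
  move=> z Fz; have [Vz|nVz] := pselect (V z.1); last by left; exact: VF1.
  have [Wz|nWz] := pselect (W z.2); last by right; exact: WF2.
  by exfalso; apply: (VWF z).
have [p [rp pg]] := exists_radon_prob cg hXY sXY tight.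
exists p; split => //; split => // [A mA|B mB].
- have [q [qE qI]] := exists_pushforward rp.1 (@continuous_fst X Y).
  have rq := radon_prob_pushforward hX (@continuous_fst X Y) qE hXY rp.
  rewrite -(radon_prob_unique hX sX rq rmu)//.
    by rewrite qE; congr (p _); apply/seteqP; split => [z []|z].
  move=> phi Cphi; rewrite qI//; apply: le_trans (g1 _ Cphi).
  by rewrite pg//; exact: (Cb_comp (@continuous_fst X Y) Cphi).
- have [q [qE qI]] := exists_pushforward rp.1 (@continuous_snd X Y).
  have rq := radon_prob_pushforward hY (@continuous_snd X Y) qE hXY rp.
  rewrite -(radon_prob_unique hY sY rq rnu)//.
    by rewrite qE; congr (p _); apply/seteqP; split => [z []|z].
  move=> psi Cpsi; rewrite qI//; apply: le_trans (g2 _ Cpsi).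
  by rewrite pg//; exact: (Cb_comp (@continuous_snd X Y) Cpsi).
Qed.

Lemma Gamma_plan (g : set (X * Y) -> R) : Gamma mu nu g ->
  exists p, Pi mu nu p /\ forall f, Cb f -> (fa_int g f = \int[p]_z (f z)%:E)%E.
Proof.
move=> [[g0 g1 gU _] gm]; apply: exists_plan => //.
- move=> phi Cphi; have := gm _ _ Cphi (Cb_cst Y 0).
  under eq_fun do rewrite addr0.
  by rewrite integral0 adde0 => <-.
- move=> psi Cpsi; have := gm _ _ (Cb_cst X 0) Cpsi.
  under eq_fun do rewrite add0r.
  by rewrite integral0 add0e => <-.
Qed.

End plans.

(** * Lower semicontinuous costs *)

Section lsc.
Context {R : realType} {Z : ptopologicalType}.
Implicit Types (p : {measure set (Borel Z) -> \bar R}).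

Lemma open_superlevel_Borel (r : Z -> R) :
  (forall t, open [set z | t < r z]) -> measurable_fun setT (r : Borel Z -> R).
Proof.
move=> or; apply: (measurability _ (RGenOInfty.measurableE R)) => //.
move=> _ [_ [a ->] <-]; rewrite setTI; apply: Borel_open.
have -> : r @^-1` `]a, +oo[ = [set z | a < r z] by apply/seteqP; split=> z /=; rewrite in_itv/= andbT.
exact: or.
Qed.

Lemma lsc_Borel (c : Z -> \bar R) :
  lower_semicontinuous c -> measurable_fun setT (c : Borel Z -> \bar R).
Proof.
move=> /lower_semicontinuousP oc.
apply: (measurability _ (ErealGenOInfty.measurableE R)) => //.
move=> _ [_ [a ->] <-]; rewrite setTI; apply: Borel_open.
by rewrite preimage_itvoy; exact: oc.
Qed.

(** Each indicator in the staircase of [r] is replaced by a bump supported in the open superlevel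
    set and equal to 1 on a compact set carrying almost all of its mass. *)
Lemma lsc_bounded_approx p (r : Z -> R) (B eps : R) :
  hausdorff_space Z -> compact_open_separated R Z -> radon_prob p ->
  (forall t, open [set z | t < r z]) -> (forall z, `|r z| <= B) -> 0 < eps ->
  exists f, [/\ Cb f, (forall z, f z <= r z) &
    (\int[p]_z (r z)%:E <= \int[p]_z (f z)%:E + eps%:E)%E].
Proof.
move=> hZ sZ [p1 pr] or rB e0; have e20 : 0 < eps / 2 by rewrite divr_gt0.
have [n [d [t [d0 rge rle]]]] := staircase rB e20.
pose U i := [set z | t i < r z].
have nd0 : 0 < n%:R * d + 1 by rewrite ltr_wpDl// mulr_ge0.
(* Half of [eps] pays for the staircase, half for the [n] mass losses of weight [d * del]; the added
   1 keeps the denominator positive when [n * d] vanishes. *)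
pose del := eps / 2 / (n%:R * d + 1).
have del0 : 0 < del by rewrite divr_gt0.
have mU i : measurable (U i : set (Borel Z)) by apply: Borel_open; exact: or.
have /choice[K KP] : forall i, exists K : set Z,
    [/\ compact K, K `<=` U i & (p (U i `\` K) < del%:E)%E].
  by move=> i; exact: pr.
have /choice[h hP] : forall i, exists h : Z -> R, [/\ continuous h,
    (forall z, 0 <= h z <= 1), (forall z, K i z -> h z = 1) & (forall z, ~ U i z -> h z = 0)].
  by move=> i; have [? ? _] := KP i; apply: sZ => //; exact: or.
have mK i : measurable (K i : set (Borel Z)).
  by apply: Borel_closed; apply: compact_closed => //; case: (KP i).
pose f z := - B + \sum_(i < n) d * h i z.
have fr z : f z <= r z.
  apply: le_trans (rge z); rewrite lerD2l ler_sum// => i _; rewrite ler_wpM2l//.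
  have [_ /(_ z)/andP[_ h1] _ h0] := hP i; rewrite indicE.
  have [//|/negP nU] := boolP (z \in _).
  by rewrite h0// => Uz; apply: nU; rewrite mem_set.
have fB z : - B <= f z.
  by rewrite lerDl sumr_ge0// => i _; rewrite mulr_ge0//; have [_ /(_ z)/andP[]] := hP i.
have Cf : Cb f.
  split.
    move=> z; apply: cvgD; first exact: cvg_cst.
    apply: (@cvg_big _ _ +%R) => [[a b]|i _]; first exact: add_continuous.
    by apply: cvgM; [exact: cvg_cst|case: (hP i) => ch _ _ _; exact: ch].
  exists B => z; rewrite ler_norml fB/=; apply: le_trans (fr z) _.
  by apply: le_trans (rB z); exact: ler_norm.
exists f; split => //.
have pfin : (p setT < +oo)%E by rewrite p1 ltry.
apply: (@le_trans _ _ (\int[p]_z (eps / 2 - B + \sum_(i < n) d * \1_(U i) z)%:E)%E).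
  apply: le_integral => //.
  - apply: (@measurable_bounded_integrable _ (Borel Z)) => //.
      exact: open_superlevel_Borel.
    by exists B; split; [exact: num_real|move=> x Bx z _ /=; apply: le_trans (rB z) _; exact: ltW].
  - exact: simple_integrable.
  - by move=> z _; rewrite lee_fin.
rewrite integral_simple//.
apply: (@le_trans _ _ (\int[p]_z (- B + \sum_(i < n) d * \1_(K i) z)%:E + eps%:E)%E); last first.
  rewrite leeD2r//; apply: le_integral => //; [exact: simple_integrable|exact: Cb_integrable|].
  move=> z _; rewrite lee_fin lerD2l ler_sum// => i _; rewrite ler_wpM2l//.
  have [_ /(_ z)/andP[h0 _] h1 _] := hP i; rewrite indicE.
  by have [/set_mem Kz|//] := boolP (z \in K i); rewrite h1.
rewrite integral_simple// -EFinD lee_fin.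
have pUK i : fine (p (U i)) <= fine (p (K i)) + del.
  have [_ KU pD] := KP i; rewrite -lee_fin EFinD !fineK ?prob_fin//.
  have := measureU2 p (mK i) (@measurableD _ (Borel Z) _ _ (mU i) (mK i)).
  by rewrite setDUK// => /le_trans; apply; rewrite leeD2l//; exact: ltW.
have : \sum_(i < n) d * fine (p (U i)) <= \sum_(i < n) d * fine (p (K i)) + eps / 2.
  apply: (@le_trans _ _ (\sum_(i < n) (d * fine (p (K i)) + d * del))).
    by apply: ler_sum => i _; rewrite -mulrDr ler_wpM2l.
  rewrite big_split/= lerD2l sumr_const card_ord -[leLHS]mulr_natl /del.
  rewrite [leLHS]mulrA [leLHS]mulrA ler_pdivrMr// mulrC ler_wpM2l ?lerDl//; exact: ltW.
lra.
Qed.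

Lemma integral_le_lsc p (f : Z -> R) (c : Z -> \bar R) :
  p setT = 1%E -> Cb f -> lower_semicontinuous c ->
  (forall z, ((f z)%:E <= c z)%E) -> (\int[p]_z (f z)%:E <= \int[p]_z c z)%E.
Proof.
move=> p1 Cf lc fc.
have mf : measurable_fun setT (EFin \o f : Borel Z -> \bar R).
  by apply/measurable_EFinP; apply: continuous_Borel; case: Cf.
have mc := lsc_Borel lc.
(* [c] may fail to be integrable, so positive and negative parts are compared separately. *)
rewrite integralE [leRHS]integralE leeB//.
- apply: ge0_le_integral => //; [exact: measurable_funepos|exact: measurable_funepos|].
  by move=> z _; rewrite !funeposE ge_max !le_max fc lexx orbT.
- apply: ge0_le_integral => //; [exact: measurable_funeneg|exact: measurable_funeneg|].
  by move=> z _; rewrite !funenegE ge_max !le_max leeN2 fc lexx orbT.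
Qed.

(** The integral of [c] may be infinite, so the proof integrates the identity between the
    nonnegative functions [c^\+ + N] and [(c + N) + c^\-], then subtracts the integral of [c^\-],
    which is at most [N]. *)
Lemma integral_lower_shift p (c : Z -> \bar R) (N : R) :
  p setT = 1%E -> lower_semicontinuous c -> 0 <= N -> (forall z, ((- N)%:E <= c z)%E) ->
  (\int[p]_z c z = \int[p]_z (c z + N%:E) - N%:E)%E.
Proof.
move=> p1 lc N0 cN; have mc := lsc_Borel lc.
have pos z : (0 <= c z + N%:E)%E by rewrite -leeBlDr// sub0e.
have intN : (\int[p]__ N%:E = N%:E)%E by rewrite integral_cst// p1 mule1.
have h : (\int[p]_z c^\+ z + N%:E = \int[p]_z (c z + N%:E) + \int[p]_z c^\- z)%E.
  rewrite -[X in (_ + X)%E = _]intN -!ge0_integralD//; first last.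
  - exact: measurable_funepos.
  - exact: measurable_funeneg.
  - by apply: emeasurable_funD.
  apply: eq_integral => z _; rewrite funeposE funenegE.
  move: (cN z); case: (c z) => [r| |]//= => [rN|_].
    rewrite -!EFin_max -!EFinD; congr EFin.
    have [r0|r0] := leP 0 r; first by rewrite max_r ?oppr_le0//; lra.
    by rewrite max_l ?oppr_ge0 ?ltW//; lra.
  by rewrite maxye maxNye addye// addye// adde0.
have hm : (\int[p]_z c^\- z <= N%:E)%E.
  rewrite -intN; apply: ge0_le_integral => //; first exact: measurable_funeneg.
  by move=> z _; rewrite funenegE ge_max leeNl -EFinN cN lee_fin.
have hf : (\int[p]_z c^\- z)%E \is a fin_num.
  by rewrite ge0_fin_numE ?integral_ge0// (le_lt_trans hm)// ltry.
rewrite integralE.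
have -> : (\int[p]_z c^\+ z = \int[p]_z (c z + N%:E) + \int[p]_z c^\- z - N%:E)%E.
  by rewrite -h addeK.
by rewrite addeAC addeK.
Qed.

Lemma integral_lsc_le p (c : Z -> \bar R) (x : \bar R) :
  hausdorff_space Z -> compact_open_separated R Z -> radon_prob p -> lsc_bi c ->
  (forall f, Cb f -> (forall z, ((f z)%:E <= c z)%E) -> (\int[p]_z (f z)%:E <= x)%E) ->
  (\int[p]_z c z <= x)%E.
Proof.
move=> hZ sZ rp [lc _ [M cM]] fx; have p1 := rp.1.
pose N := `|M|.
have cN z : ((- N)%:E <= c z)%E.
  by apply: le_trans (cM z); rewrite lee_fin lerNl /N -normrN ler_norm.
rewrite (integral_lower_shift p1 lc (normr_ge0 M) cN) -/N leeBlDr//.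
have pos z : (0 <= c z + N%:E)%E by rewrite -leeBlDr// sub0e.
rewrite ge0_integralTE//; apply: ge_ereal_sup => _ [h hc <-].
have [B' hB'] : exists B', forall z, h z <= B'.
  have [B' hB'] := @simple_bounded _ (Borel Z) _ h.
  by exists (B' + 1) => z; have := hB'.2 (B' + 1); rewrite ltrDl => /(_ ltr01 z I)/=; apply: le_trans; exact: ler_norm.
(* High enough for [h - N] to stay below the truncation of [c] at [B], and at least [N] so that the
   truncation is bounded by [B] in absolute value. *)
pose B := `|B'| + N.
have NB : N <= B by rewrite lerDr.
pose r z := fine (mine (c z) B%:E).
have rE z : (r z)%:E = mine (c z) B%:E.
  rewrite /r fineK//; move: (cN z); case: (c z) => [s| |]//= _; by rewrite -EFin_min.
have rB z : `|r z| <= B.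
  rewrite ler_norml -!lee_fin rE ge_min lexx orbT andbT le_min.
  rewrite (le_trans _ (cN z)) ?lee_fin ?lerN2//=.
  by rewrite (le_trans (_ : _ <= 0)) ?oppr_le0 ?addr_ge0 ?normr_ge0.
have or t : open [set z | t < r z].
  have [tB|Bt] := ltP t B.
    have -> : [set z | t < r z] = [set z | (t%:E < c z)%E].
      by apply/seteqP; split=> z /=; rewrite -lte_fin rE lt_min lte_fin tB andbT.
    by move/lower_semicontinuousP : lc; exact.
  have -> : [set z | t < r z] = set0; last exact: open0.
  apply/seteqP; split=> // z /=; rewrite ltNge => /negP; apply.
  by apply: le_trans Bt; apply: le_trans (rB z); exact: ler_norm.
apply/lee_addgt0Pr => e e0.
have [f [Cf fr hf]] := lsc_bounded_approx hZ sZ rp or rB e0.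
have fxx : (\int[p]_z (f z)%:E <= x)%E.
  apply: fx => // z; apply: (@le_trans _ _ (r z)%:E); first by rewrite lee_fin.
  by rewrite rE ge_min lexx.
rewrite addeAC -leeBlDr//; apply: (@le_trans _ _ (\int[p]_z (f z)%:E + e%:E)%E); last exact: leeD2r.
apply: le_trans hf.
have pfin : (p setT < +oo)%E by rewrite p1 ltry.
have ih : p.-integrable setT (EFin \o h).
  apply: (@measurable_bounded_integrable _ (Borel Z)) => //.
  exists B'; split; first exact: num_real.
  by move=> y By z _ /=; rewrite ger0_norm//; apply: le_trans (hB' z) _; exact: ltW.
have iN : p.-integrable setT (EFin \o (fun _ : Borel Z => N)).
  apply: (@measurable_bounded_integrable _ (Borel Z)) => //.
  by exists `|N|; split; [exact: num_real|move=> y By z _ /=; exact: ltW].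
have <- : (\int[p]_z (h z - N)%:E = sintegral p h - N%:E)%E.
  under eq_integral do rewrite EFinB.
  by rewrite integralB// integralT_nnsfun integral_cst// p1 mule1.
apply: le_integral => //.
- by under eq_fun do rewrite EFinB; exact: integrableB.
- apply: (@measurable_bounded_integrable _ (Borel Z)) => //.
    exact: open_superlevel_Borel.
  by exists B; split; [exact: num_real|move=> y By z _ /=; apply: le_trans (rB z) _; exact: ltW].
- move=> z _; rewrite rE le_min EFinB leeBlDr// hc/= -EFinD lee_fin.
  rewrite lerBlDr; apply: (le_trans (hB' z)); rewrite /B -addrA ler_wpDr ?ler_norm//.
  by rewrite addr_ge0 ?normr_ge0.
Qed.

Lemma lsc_int_prob p (c : Z -> \bar R) :
  hausdorff_space Z -> compact_open_separated R Z -> radon_prob p -> lsc_bi c ->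
  lsc_int (fun A => fine (p A)) c = (\int[p]_z c z)%E.
Proof.
move=> hZ sZ rp lc; have p1 := rp.1.
apply/eqP; rewrite eq_le; apply/andP; split.
  apply: ge_ereal_sup => _ [f [Cf fc] <-]; rewrite fa_int_prob//.
  by apply: integral_le_lsc => //; case: lc.
apply: integral_lsc_le => // f Cf fc; rewrite -fa_int_prob//.
by apply: ereal_sup_ubound; exists f.
Qed.

End lsc.

(** * Ultrafilter limits and existence *)

(** Compactness of the unit interval gives a cluster point, and an ultrafilter, containing each set
    or its complement, converges to its cluster points. *)
Lemma ultra_bounded_cvg (R : realType) (T : Type) (G : set_system T) (u : T -> R) :
  UltraFilter G -> (forall n, 0 <= u n <= 1) -> exists l : R, u n @[n --> G] --> l.
Proof.
move=> UG u01; have PG : ProperFilter G by exact: ultra_proper.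
have [l [_ ul]] : `[0, 1]%classic `&` cluster (u n @[n --> G]) !=set0.
  by apply: segment_compact; apply: nearW => n; rewrite /= in_itv/= u01.
exists l => A lA; have [//|GA] := in_ultra_setVsetC (u @^-1` A) UG.
have [|y [nAy Ay]] := ul (~` A) A _ lA; first exact: GA.
by [].
Qed.

Section limit_plan.
Context {R : realType} {Z : ptopologicalType}.
Variables (G : set_system nat) (p : nat -> {measure set (Borel Z) -> \bar R}).
Hypothesis UG : UltraFilter G.
Hypothesis p1 : forall n, p n setT = 1%E.

(** An ultrafilter makes the values converge on all sets of the algebra at once; the algebra may be
    uncountable, so a diagonal subsequence need not exist. *)
Lemma exists_limit_content : exists g : set Z -> R, fa_content g /\
  forall A, @Ualg R Z A -> fine (p n A) @[n --> G] --> g A.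
Proof.
have PG : ProperFilter G by exact: ultra_proper.
have /choice[g gP] : forall A, exists l : R, @Ualg R Z A -> fine (p n A) @[n --> G] --> l.
  move=> A; have [UA|] := pselect (@Ualg R Z A); last by exists 0.
  have [|l ul] := @ultra_bounded_cvg R nat G (fun n => fine (p n A)) UG; last by exists l.
  move=> n; rewrite fine_ge0//= -lee_fin fineK.
    exact: prob_le1 (p1 n) (Ualg_Borel UA).
  exact: prob_fin (p1 n) (Ualg_Borel UA).
exists g; split=> //; split=> [A UA||A B UA UB AB0].
- apply: (cvgr_to_ge (gP _ UA)); apply: nearW => n; exact: fine_ge0.
- apply: (@cvg_unique _ (@Rhausdorff R) _ _ _ _ (gP _ UalgT)).
  have -> : (fun n => fine (p n setT)) = cst 1 by apply/funext => n; rewrite /= p1.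
  exact: cvg_cst.
- apply: (@cvg_unique _ (@Rhausdorff R) _ _ _ _ (gP _ (UalgU UA UB))).
  have -> : (fun n => fine (p n (A `|` B))) = (fun n => fine (p n A) + fine (p n B)).
    by apply/funext => n; have [_ _ ->] := prob_content (p1 n).
  by apply: cvgD; exact: gP.
Qed.

(** A step function below [f] involves finitely many sets, so its value under [g] is the limit of
    its values under [p n], each at most the integral of [f]. *)
Lemma fa_int_limit_le (g : set Z -> R) (f : Z -> R) (x : R) :
  (forall A, @Ualg R Z A -> fine (p n A) @[n --> G] --> g A) -> Cb f ->
  (forall e, 0 < e -> \forall n \near G, (\int[p n]_z (f z)%:E <= (x + e)%:E)%E) ->
  (fa_int g f <= x%:E)%E.
Proof.
have PG : ProperFilter G by exact: ultra_proper.
move=> gP Cf px; apply: ge_ereal_sup => _ [n [a [A [UA af ->]]]].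
rewrite lee_fin; apply/ler_addgt0Pr => e e0.
have : \sum_(i < n) a i * fine (p k (A i)) @[k --> G] --> \sum_(i < n) a i * g (A i).
  apply: (@cvg_big _ _ +%R) => [[b c]|i _]; first exact: add_continuous.
  by apply: cvgM; [exact: cvg_cst|exact: gP].
move=> /cvgr_to_le; apply; apply: filterS (px _ e0) => k pk.
rewrite -lee_fin; apply: le_trans pk; rewrite -fa_int_prob//.
by apply: ereal_sup_ubound; exists n, a, A.
Qed.

End limit_plan.

(** * Optimal plans and equality of the two values *)

Section existence.
Context {R : realType} {X Y : ptopologicalType}.
Hypothesis hX : hausdorff_space X.
Hypothesis hY : hausdorff_space Y.
Hypothesis sX : compact_open_separated R X.
Hypothesis sY : compact_open_separated R Y.
Variables (mu : {measure set (Borel X) -> \bar R}) (nu : {measure set (Borel Y) -> \bar R}).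
Hypothesis rmu : radon_prob mu.
Hypothesis rnu : radon_prob nu.

Lemma vmin_KP_bounded (c : X * Y -> \bar R) : lsc_bi c -> exists N : R, (N%:E <= vmin_KP mu nu c)%E.
Proof.
move=> [lc _ [M cM]]; exists M; apply: le_ereal_inf_tmp => _ [p [[p1 _] _ _] <-].
have := @integral_le_lsc R (X * Y)%type p (fun=> M) c p1 (Cb_cst _ _) lc cM.
by rewrite integral_cst// p1 mule1.
Qed.

Lemma exists_optimal_plan (c : X * Y -> \bar R) : lsc_bi c ->
  (vmin_KP mu nu c < +oo)%E ->
  exists p, Pi mu nu p /\ (\int[p]_z c z)%E = vmin_KP mu nu c.
Proof.
move=> lc vfin; have [N vN] := vmin_KP_bounded lc.
have vfn : vmin_KP mu nu c \is a fin_num.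
  by rewrite fin_numElt vfin andbT (lt_le_trans _ vN)// ltNyr.
pose v := fine (vmin_KP mu nu c).
have vE : vmin_KP mu nu c = v%:E by rewrite fineK.
have /choice[p pP] : forall n : nat, exists p, Pi mu nu p /\
    (\int[p]_z c z <= (v + n.+1%:R^-1)%:E)%E.
  move=> n; have n0 : 0 < n.+1%:R^-1 :> R by rewrite invr_gt0 ltr0n.
  have [_ [p Pip <-] h] := lb_ereal_inf_adherent n0 vfn.
  exists p; split => //; apply: ltW; apply: (lt_le_trans h).
  by rewrite EFinD -vE.
have p1 n : p n setT = 1%E by have [[[]]] := pP n.
(* The ultrafilter refines the tails of [nat], so estimates valid for large [n] hold along it. *)
have [G [UG sG]] := ultraFilterLemma (@eventually_filter).
have [g [cg gP]] := exists_limit_content UG p1.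
have [phi Cphi|psi Cpsi|q [Piq qg]] := @exists_plan R X Y hX hY sX sY mu nu rmu rnu g cg.
- have Cf := Cb_comp (@continuous_fst X Y) Cphi.
  have ifin : (\int[mu]_x (phi x)%:E)%E \is a fin_num.
    by apply: integrable_fin_num => //; apply: Cb_integrable => //; exact: rmu.1.
  rewrite -(fineK ifin); apply: (fa_int_limit_le UG p1 gP Cf) => e e0.
  apply: nearW => n; rewrite (integral_fst (pP n).1 Cphi) EFinD fineK// leeDl// lee_fin; exact: ltW.
- have Cf := Cb_comp (@continuous_snd X Y) Cpsi.
  have ifin : (\int[nu]_x (psi x)%:E)%E \is a fin_num.
    by apply: integrable_fin_num => //; apply: Cb_integrable => //; exact: rnu.1.
  rewrite -(fineK ifin); apply: (fa_int_limit_le UG p1 gP Cf) => e e0.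
  apply: nearW => n; rewrite (integral_snd (pP n).1 Cpsi) EFinD fineK// leeDl// lee_fin; exact: ltW.
exists q; split => //; apply/eqP; rewrite eq_le; apply/andP; split; last first.
  by apply: ereal_inf_lbound; exists q.
(* The cost of [q] is tested on continuous minorants of [c], whose integrals survive the limit. *)
rewrite vE; apply: integral_lsc_le => //.
- exact: hausdorff_prod.
- exact: prod_compact_open_separated.
- by case: Piq.
move=> f Cf fc; rewrite -qg//; apply: (fa_int_limit_le UG p1 gP Cf) => e e0.
apply: sG; exists (Num.truncn e^-1) => // n /= ne.
apply: (@le_trans _ _ (\int[p n]_z c z)%E).
  by apply: integral_le_lsc => //; case: lc.
apply: le_trans (pP n).2 _; rewrite lee_fin lerD2l invf_ple ?posrE ?ltr0n//.
by apply: ltW; apply: lt_le_trans (truncnS_gt _) _; rewrite ler_nat ltnS.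
Qed.

Lemma vmin_OP_KP (c : X * Y -> \bar R) : lsc_bi c -> vmin_OP mu nu c = vmin_KP mu nu c.
Proof.
move=> lc; have hXY := hausdorff_prod hX hY.
have sXY := prod_compact_open_separated sX sY.
apply/eqP; rewrite eq_le; apply/andP; split.
- apply: le_ereal_inf_tmp => _ [p Pip <-]; rewrite -lsc_int_prob//; last by case: Pip.
  by apply: ereal_inf_lbound; exists (fun A => fine (p A)) => //; exact: Pi_Gamma.
- apply: le_ereal_inf_tmp => _ [g Gg <-]; have [p [Pip pg]] := Gamma_plan hX hY sX sY rmu rnu Gg.
  have p1 : p setT = 1%E by case: Pip => -[].
  (* [lsc_int] depends on the content only through its values on C_b, which [g] shares with [p]. *)
  suff -> : lsc_int g c = (\int[p]_z c z)%E by apply: ereal_inf_lbound; exists p.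
  rewrite -lsc_int_prob//; last by case: Pip.
  rewrite /lsc_int; congr ereal_sup; apply/seteqP.
  by split=> _ [f [Cf fc] <-]; exists f => //; rewrite fa_int_prob// pg.
Qed.

End existence.

Theorem mainTheorem10 (R : realType) (X Y : ptopologicalType)
  (hX : perfectly_normal X) (hX2 : hausdorff_space X)
  (hY : perfectly_normal Y) (hY2 : hausdorff_space Y)
  (mu : {measure set (Borel X) -> \bar R})
  (nu : {measure set (Borel Y) -> \bar R})
  (hmu : radon_prob mu) (hnu : radon_prob nu) :
  [/\ (* every gamma in Gamma(mu,nu) is represented by some element of Pi *)
      (forall g : set (X * Y) -> R, Gamma mu nu g ->
         exists p, Pi mu nu p /\
           forall f : X * Y -> R, Cb f -> fa_int g f = (\int[p]_z (f z)%:E)%E),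
      (* every element of Pi, restricted to U(X x Y), lies in Gamma *)
      (forall p, Pi mu nu p -> Gamma mu nu (fun A => fine (p A))),
      (* the objectives of (OP) and (KP) agree on Pi *)
      (forall p, Pi mu nu p -> forall c : X * Y -> \bar R, lsc_bi c ->
         lsc_int (fun A => fine (p A)) c = (\int[p]_z c z)%E),
      (* the values coincide *)
      (forall c : X * Y -> \bar R, lsc_bi c -> vmin_OP mu nu c = vmin_KP mu nu c) &
      (* existence of an optimal plan for (KP) *)
      (forall c : X * Y -> \bar R, lsc_bi c -> (vmin_KP mu nu c < +oo)%E ->
         exists p, Pi mu nu p /\ (\int[p]_z c z)%E = vmin_KP mu nu c)].
Proof.
have sX : compact_open_separated R X := normal_compact_open_separated hX.1 hX2.
have sY : compact_open_separated R Y := normal_compact_open_separated hY.1 hY2.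
split.
- exact: (Gamma_plan hX2 hY2 sX sY hmu hnu).
- exact: Pi_Gamma.
- move=> p [rp _ _] c lc; apply: lsc_int_prob => //.
    exact: hausdorff_prod.
  exact: prod_compact_open_separated.
- exact: (vmin_OP_KP hX2 hY2 sX sY hmu hnu).
- exact: (exists_optimal_plan hX2 hY2 sX sY hmu hnu).
Qed.
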